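(* Let $r\geq 1$ be an integer and let $H$ be a fixed graph with chromatic number $\chi(H)=r+1$. Then there is a constant $C=C(H)$ such that for every $\varepsilon>0$ there exists $n_0$ with the following property. Whenever $n\geq n_0$ and $G$ is an $n$-vertex graph with minimum degree \[\delta(G)>\left(1-\frac{3}{3r-1}+\varepsilon\right)n\] which does not contain $H$ as a subgraph, one can delete at most $C\,\mathrm{biex}(n,H)$ edges from $G$ to obtain an $r$-partite graph.
   Context: For a graph $H$ with chromatic number $\chi(H)$, consider every proper colouring $c:V(H)\to\{1,\dots,\chi(H)\}$ of $H$ with $\chi(H)$ colours, and let $S_c=c^{-1}(\{1,2\})$ be the set of vertices receiving colours $1$ or $2$. Let $\mathcal{F}$ be the family of all graphs $H[S_c]$ (the subgraph of $H$ induced by $S_c$) over all such colourings $c$. Then $\mathrm{biex}(n,H)$ is defined to be $\mathrm{ex}(n,\mathcal{F})$, the maximum number of edges in an $n$-vertex graph containing no subgraph isomorphic to any member of $\mathcal{F}$. A graph is $r$-partite if its vertex set can be partitioned into $r$ independent sets. *)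

(* Defs.v *)
From HB Require Import structures.
From mathcomp Require Import all_boot all_order all_algebra.
From mathcomp Require Import reals.

Set Implicit Arguments.
Unset Strict Implicit.
Unset Printing Implicit Defensive.

(* A simple graph on the vertex type T is a set of 2-element subsets of T, so
   graphs on T form a finType and #|edges G| is the number of edges. *)
Record sgraph (T : finType) := SGraph {
  edges : {set {set T}};
  edges_card2 : [forall e in edges, #|e| == 2] }.

HB.instance Definition _ (T : finType) := [isSub for @edges T].
HB.instance Definition _ (T : finType) := [Finite of sgraph T by <:].

Definition adj (T : finType) (G : sgraph T) : rel T :=
  fun x y => [set x; y] \in edges G.

Lemma adj_irrefl (T : finType) (G : sgraph T) : irreflexive (adj G).
Proof.
move=> x; apply/negP => /(forall_inP (edges_card2 G)).
by rewrite setUid cards1.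
Qed.

Definition degree (T : finType) (G : sgraph T) (x : T) : nat :=
  #|[set y | adj G x y]|.

(* Every degree is less than #|T|, so the default value #|T| only matters when
   T is empty. *)
Definition min_degree (T : finType) (G : sgraph T) : nat :=
  \big[minn/#|T|]_(x : T) degree G x.

(* Subgraph containment, not necessarily induced. *)
Definition contains (T U : finType) (K : sgraph T) (G : sgraph U) : bool :=
  [exists f : {ffun T -> U},
     injectiveb f && [forall x, forall y, adj K x y ==> adj G (f x) (f y)]].

Definition proper_colouring (T : finType) (G : sgraph T) (k : nat)
    (c : {ffun T -> 'I_k}) : bool :=
  [forall x, forall y, adj G x y ==> (c x != c y)].

Definition colourable (T : finType) (G : sgraph T) (k : nat) : bool :=
  [exists c : {ffun T -> 'I_k}, proper_colouring G c].

Lemma ex_colourable (T : finType) (G : sgraph T) : exists k, colourable G k.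
Proof.
exists #|T|; apply/existsP; exists [ffun x => enum_rank x].
apply/forallP => x; apply/forallP => y; apply/implyP => xy.
rewrite !ffunE (inj_eq enum_rank_inj).
by apply/eqP => exy; rewrite exy adj_irrefl in xy.
Qed.

Definition chi (T : finType) (G : sgraph T) : nat := ex_minn (ex_colourable G).

Section Induced.
Variables (T : finType) (G : sgraph T) (S : {set T}).

Definition induced_edges : {set {set {x : T | x \in S}}} :=
  [set e : {set {x : T | x \in S}} | val @: e \in edges G].

Lemma induced_card2 : [forall e in induced_edges, #|e| == 2].
Proof.
apply/forall_inP => e; rewrite inE => /(forall_inP (edges_card2 G)).
by rewrite card_imset //; apply: val_inj.
Qed.

Definition induced : sgraph {x : T | x \in S} := SGraph induced_card2.
End Induced.

Section DelEdges.
Variables (T : finType) (G : sgraph T) (D : {set {set T}}).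

Lemma del_edges_card2 : [forall e in edges G :\: D, #|e| == 2].
Proof.
apply/forall_inP => e; rewrite inE => /andP[_].
exact: (forall_inP (edges_card2 G)).
Qed.

Definition del_edges : sgraph T := SGraph del_edges_card2.
End DelEdges.

Definition independent (T : finType) (G : sgraph T) (A : {set T}) : bool :=
  [forall x in A, forall y in A, ~~ adj G x y].

(* Parts are allowed to be empty. *)
Definition partite (T : finType) (r : nat) (G : sgraph T) : bool :=
  [exists A : {ffun 'I_r -> {set T}},
    [&& \bigcup_i A i == [set: T],
        [forall i, forall j, (i != j) ==> [disjoint A i & A j]] &
        [forall i, independent G (A i)]]].

(* ex(n, F) for a finite family F of graphs.  The maximum of an empty set of
   graphs is 0; it is nonempty as soon as every F i has an edge. *)
Definition ex_fam (n : nat) (I : finType) (V : I -> finType)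
    (F : forall i, sgraph (V i)) : nat :=
  \max_(G : sgraph 'I_n | [forall i, ~~ contains (F i) G]) #|edges G|.

(* The colours 1, ..., chi H are the ordinals 0, ..., chi H - 1, so the first
   two colours are those of value less than 2. *)
Definition two_classes (T : finType) (k : nat) (c : {ffun T -> 'I_k}) :
    {set T} := [set x | (c x < 2)%N].

Definition biex (n : nat) (T : finType) (H : sgraph T) : nat :=
  @ex_fam n {c : {ffun T -> 'I_(chi H)} | proper_colouring H c}
    (fun c => {x : T | x \in two_classes (val c)})
    (fun c => induced H (two_classes (val c))).

(* Main.v *)
(* Write n for the number of vertices and put k = r - 1.  A part-by-part averaging
   argument shows that many (k+2)-cliques would force a complete (k+2)-partite
   graph with large parts, hence a copy of H, so G has o(n^(k+2)) cliques of order
   k+2.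

   The Andrasfai-Erdos-Sos bound is then proved approximately, by counting.  Call x
   and z alike if their common neighbourhood contains a positive proportion of all
   k-sets as cliques.  Weighting the vertices of a "conflict" x ~ y with x, z alike
   and y, z alike, witnessed by k-cliques P and Q, the degree condition gives many
   vertices missing at most two of its 2k+3 vertices; each of these creates a
   (k+2)-clique or a conflict with smaller cliques in its link, so conflicts are
   rare.  This is the only step that uses eps.  A similar weighting, where a vertex
   is exchanged into a (k+1)-clique Z, shows that almost every x is alike to some
   vertex of a typical Z.  Hence the classes "alike to z", z in Z, give r parts with
   few edges inside.

   Given these parts, the degree condition has slack independent of eps: a vertex
   with many neighbours in every part has many (k+1)-cliques in its neighbourhood
   (a "bad" vertex), and any two other vertices attached to the same part have many
   k-cliques in their common neighbourhood.  So deleting the edges at bad vertices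
   and the "heavy" edges, those contained in many (k+2)-cliques, leaves an r-partite
   graph.  By averaging, a constant proportion of the heavy edges is joined to one
   complete k-partite graph with large parts, so that these edges contain no member
   of the family defining biex; and there are boundedly many bad vertices, none if
   biex(n, H) < n - 1, because then some member of the family is contained in a
   star. *)
Require Import Defs.
From mathcomp Require Import all_boot all_order all_algebra.
From mathcomp Require Import reals zify lra.

Set Implicit Arguments.
Unset Strict Implicit.
Unset Printing Implicit Defensive.

(** * Counting cliques *)

Lemma card_pairs (A B : finType) (S : {set A}) (F : A -> {set B}) :
  #|[set p : A * B | (p.1 \in S) && (p.2 \in F p.1)]| = \sum_(a in S) #|F a|.
Proof.
rewrite cardsE -sum1_card.
rewrite (eq_bigl (fun p : A * B => (p.1 \in S) && (p.2 \in F p.1))) //.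
rewrite -(pair_big_dep (mem S) (fun a b => b \in F a) (fun _ _ => 1)) /=.
by apply: eq_bigr => a _; rewrite sum1_card.
Qed.

Lemma leq_card_map (A B : finType) (S : {set A}) (T : {set B}) (f : A -> B) :
  {in S &, injective f} -> (forall a, a \in S -> f a \in T) -> #|S| <= #|T|.
Proof.
move=> finj fT; rewrite -(card_in_imset finj); apply: subset_leq_card.
by apply/subsetP => _ /imsetP[a aS ->]; apply: fT.
Qed.

Lemma sum_leq_card (A : finType) (S : {set A}) (f : A -> nat) (c : nat) :
  (forall a, a \in S -> f a <= c) -> \sum_(a in S) f a <= #|S| * c.
Proof. by move=> fc; rewrite -sum_nat_const; apply: leq_sum. Qed.

Lemma card_low (A : finType) (S : {set A}) (w : A -> nat) (t b : nat) :
  \sum_(v in S) w v <= b -> t * #|S| <= b + t * #|[set v in S | w v < t]|.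
Proof.
move=> wb; have -> : #|S| = #|[set v in S | w v < t]| + #|[set v in S | t <= w v]|.
  rewrite -cardsUI [X in _ + X]eq_card0 ?addn0.
    by apply: eq_card => v; rewrite !inE; case: (v \in S) => //=; case: ltnP.
  by move=> v; rewrite !inE; case: (v \in S) => //=; case: ltnP.
rewrite mulnDr addnC leq_add2r; apply: leq_trans wb.
rewrite mulnC -sum_nat_const [leqRHS](bigID (fun v => t <= w v)) /=.
apply: leq_trans (leq_addr _ _).
rewrite (eq_bigl (fun v => (v \in S) && (t <= w v))) => [|v]; last by rewrite inE.
by apply: leq_sum => v /andP[].
Qed.

Lemma exists_sum_ge (A : finType) (S : {set A}) (f : A -> nat) (c : nat) :
  0 < #|S| -> c * #|S| <= \sum_(a in S) f a -> exists2 a, a \in S & c <= f a.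
Proof.
move=> S0 cS; case: (boolP [exists a in S, c <= f a]) => [/exists_inP //|].
rewrite negb_exists_in => /forall_inP lt; exfalso.
have /card_gt0P[a0 a0S] := S0.
suff: \sum_(a in S) f a < c * #|S| by lia.
rewrite mulnC -sum_nat_const (bigD1 a0) //= [ltnRHS](bigD1 a0) //=.
rewrite -addSn; apply: leq_add; first by rewrite ltnNge lt.
by apply: leq_sum => a /andP[aS _]; apply: ltnW; rewrite ltnNge lt.
Qed.

Lemma exists_sum_le (A : finType) (S : {set A}) (f : A -> nat) (c : nat) :
  0 < #|S| -> \sum_(a in S) f a <= c * #|S| -> exists2 a, a \in S & f a <= c.
Proof.
move=> S0 cS; case: (boolP [exists a in S, f a <= c]) => [/exists_inP //|].
rewrite negb_exists_in => /forall_inP lt; exfalso.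
suff: c.+1 * #|S| <= \sum_(a in S) f a by rewrite mulSn; lia.
by rewrite mulnC -sum_nat_const; apply: leq_sum => a aS; rewrite ltnNge lt.
Qed.

Section Cliques.
Variables (U : finType) (G : sgraph U).
Implicit Types (S P Z : {set U}) (x y z u v : U).

Definition nbhd x : {set U} := [set y | adj G x y].

Lemma adj_sym : symmetric (adj G).
Proof. by move=> x y; rewrite /adj setUC. Qed.

Lemma in_nbhd x y : (y \in nbhd x) = adj G x y.
Proof. by rewrite inE. Qed.

Lemma nbhdC x y : (y \in nbhd x) = (x \in nbhd y).
Proof. by rewrite !in_nbhd adj_sym. Qed.

Lemma nbhd_irrefl x : (x \in nbhd x) = false.
Proof. by rewrite in_nbhd adj_irrefl. Qed.

Definition clique P := [forall x in P, forall y in P, (x != y) ==> adj G x y].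

Lemma cliqueP P :
  reflect (forall x y, x \in P -> y \in P -> x != y -> adj G x y) (clique P).
Proof.
apply: (iffP forall_inP) => [cP x y xP yP|cP x xP].
  by move/forall_inP: (cP x xP) => /(_ y yP) /implyP.
by apply/forall_inP => y yP; apply/implyP; apply: cP.
Qed.

Definition cliques k S : {set {set U}} :=
  [set P : {set U} | [&& P \subset S, #|P| == k & clique P]].

Lemma cliquesP k S P :
  reflect [/\ P \subset S, #|P| = k & clique P] (P \in cliques k S).
Proof. by rewrite inE; apply: (iffP and3P) => -[? /eqP ? ?]; split=> //; apply/eqP. Qed.

Lemma cliquesS k S S' : S \subset S' -> cliques k S \subset cliques k S'.
Proof.
move=> SS'; apply/subsetP => P /cliquesP[PS Pk cP].
by apply/cliquesP; split=> //; apply: subset_trans SS'.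
Qed.

Lemma cliquesU1 k S u P :
  u \in S -> P \in cliques k (S :&: nbhd u) -> u |: P \in cliques k.+1 S.
Proof.
move=> uS /cliquesP[]; rewrite subsetI => /andP[PS PN] Pk /cliqueP cP.
apply/cliquesP; split.
- by rewrite subUset sub1set uS.
- rewrite cardsU1 Pk (contraFN _ (nbhd_irrefl u)) ?add1n //.
  exact: (subsetP PN).
apply/cliqueP => x y; rewrite !in_setU1.
case/orP=> [/eqP->|xP] /orP[/eqP->|yP]; rewrite ?eqxx //; last exact: cP.
  by rewrite -in_nbhd (subsetP PN).
by rewrite -in_nbhd nbhdC (subsetP PN).
Qed.

Lemma cliquesD1 k S u P :
  P \in cliques k.+1 S -> u \in P -> P :\ u \in cliques k (S :&: nbhd u).
Proof.
move=> /cliquesP[PS Pk /cliqueP cP] uP; apply/cliquesP; split.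
- apply/subsetP => x; rewrite !inE => /andP[xu xP].
  by rewrite (subsetP PS) //= cP // eq_sym.
- by apply/eqP; move: Pk; rewrite (cardsD1 u) uP add1n => -[->].
by apply/cliqueP => x y; rewrite !inE => /andP[_ xP] /andP[_ yP]; apply: cP.
Qed.

Lemma sum_cliques_link k S :
  \sum_(u in S) #|cliques k (S :&: nbhd u)| = k.+1 * #|cliques k.+1 S|.
Proof.
rewrite mulnC -sum_nat_const.
rewrite (eq_bigr (fun P : {set U} => #|P|)); last first.
  by move=> P /cliquesP[].
rewrite -!card_pairs; apply/eqP; rewrite eqn_leq; apply/andP; split.
  apply: (@leq_card_map _ _ _ _ (fun p => (p.1 |: p.2, p.1))) => [[u P] [v Q]|[u P]].
    rewrite !inE /= => /andP[_ /andP[PS _]] /andP[_ /andP[QS _]] [PQ uv].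
    subst v; congr (_, _).
    have nP (R : {set U}) : R \subset S :&: nbhd u -> u \notin R.
      by move=> RS; apply/negP => /(subsetP RS); rewrite in_setI nbhd_irrefl andbF.
    by rewrite -(setU1K (nP _ PS)) PQ setU1K // nP.
  rewrite [X in is_true X -> _]in_set [X in _ -> is_true X]in_set /= => /andP[uS uP].
  by rewrite setU11 andbT cliquesU1.
apply: (@leq_card_map _ _ _ _ (fun p => (p.2, p.1 :\ p.2))) => [[P u] [Q v]|[P u]].
  rewrite !in_set /= => /andP[_ uP] /andP[_ vQ] [uv PQ]; subst v; congr (_, _).
  by rewrite -(setD1K uP) PQ setD1K.
rewrite [X in is_true X -> _]in_set [X in _ -> is_true X]in_set /= => /andP[Pk uP].
rewrite (cliquesD1 Pk) // andbT.
by case/cliquesP: Pk => /subsetP PS _ _; apply: PS.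
Qed.

Lemma card_cliques k S : #|cliques k S| <= #|U| ^ k.
Proof.
elim: k S => [|k IH] S.
  rewrite expn0 -(cards1 (set0 : {set U})); apply: subset_leq_card.
  by apply/subsetP => P /cliquesP[_ /cards0_eq -> _]; rewrite inE.
apply: leq_trans (leq_pmull _ (ltn0Sn k)) _; rewrite -sum_cliques_link.
apply: leq_trans (_ : \sum_(u in S) #|U| ^ k <= _); first exact: leq_sum.
rewrite sum_nat_const expnS.
by rewrite leq_mul2r max_card orbT.
Qed.

Lemma cliques0 S : #|cliques 0 S| = 1.
Proof.
apply/eqP; rewrite eqn_leq -{1}(expn0 #|U|) card_cliques; apply/card_gt0P.
exists set0; apply/cliquesP; split; rewrite ?sub0set ?cards0 //.
by apply/cliqueP => x; rewrite inE.
Qed.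

End Cliques.

(** * Complete multipartite subgraphs from many cliques *)

Lemma leq_expl m n e : m <= n -> m ^ e <= n ^ e.
Proof. by case: e => // e; rewrite leq_exp2r. Qed.

Lemma exp_leq_ffact a t : (a - t) ^ t <= a ^_ t.
Proof.
elim: t a => [|t IH] a; first by rewrite expn0 ffactn0.
case: a => [|a]; first by rewrite exp0n.
by rewrite ffactSS subSS expnS leq_mul ?IH //; lia.
Qed.

Lemma pick_part (V U : finType) (G : sgraph U) (E : finType) (X : {set E})
    (S : E -> {set U}) (k q : nat) :
  0 < #|U| -> 4 * q * #|V| <= #|U| -> 0 < #|X| ->
  #|U| ^ k.+1 * #|X| <= q * \sum_(e in X) #|cliques G k.+1 (S e)| ->
  exists g : {ffun V -> U}, injective g /\
    #|U| ^ k * #|X| <= (4 * q) ^ #|V| * (2 * q) *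
      \sum_(e in [set e in X | [forall w, g w \in S e]])
        #|cliques G k (S e :&: [set u | [forall w, adj G (g w) u]])|.
Proof.
move=> U0 qV X0 dense; set n := #|U| in U0 qV dense *; set t := #|V| in qV *.
pose D := [set p : E * {set U} | (p.1 \in X) && (p.2 \in cliques G k (S p.1))].
pose A (p : E * {set U}) := [set u in S p.1 | p.2 \subset nbhd G u].
have Dle : #|D| <= #|X| * n ^ k.
  rewrite (card_pairs X (fun e => cliques G k (S e))) -sum_nat_const.
  by apply: leq_sum => e _; exact: card_cliques.
have An p : #|A p| <= n by exact: max_card.
have sumA : \sum_(e in X) #|cliques G k.+1 (S e)| <= \sum_(p in D) #|A p|.
  have -> : \sum_(p in D) #|A p| =
      \sum_(e in X) \sum_(P in cliques G k (S e)) #|A (e, P)|.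
    rewrite pair_big_dep /=; apply: eq_big => [p|[e P] _] //.
    by rewrite inE.
  apply: leq_sum => e _.
  apply: leq_trans (leq_pmull _ (ltn0Sn k)) _; rewrite -sum_cliques_link -!card_pairs.
  apply: (@leq_card_map _ _ _ _ (fun p => (p.2, p.1))) => [[u P] [v Q] _ _ [-> ->] //|[u P]].
  rewrite [X in is_true X -> _]in_set [X in _ -> is_true X]in_set /=.
  move=> /andP[uS /cliquesP[]]; rewrite subsetI => /andP[PS PN] Pk cP.
  apply/andP; split; first exact/cliquesP.
  by rewrite inE /= uS PN.
pose D' := [set p in D | n <= 2 * q * #|A p|].
have D'ge : n ^ k * #|X| <= 2 * q * #|D'|.
  have : 2 * q * \sum_(p in D) #|A p| <= n * #|D| + 2 * q * n * #|D'|.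
    rewrite big_distrr /= (big_setID D') /= addnC [n * _]mulnC [2 * q * n * _]mulnC.
    apply: leq_add; last first.
      apply: leq_trans (sum_leq_card _) (_ : #|D :&: D'| * (2 * q * n) <= _).
        by move=> p _; rewrite leq_mul2l An orbT.
      by rewrite leq_mul2r subset_leq_card ?subsetIr ?orbT.
    apply: leq_trans (sum_leq_card _) (_ : #|D :\: D'| * n <= _).
      by move=> p; rewrite !inE negb_and => /andP[/orP[/negP //|]]; rewrite -ltnNge => /ltnW.
    by rewrite leq_mul2r subset_leq_card ?subsetDl ?orbT.
  move=> H; rewrite -(leq_pmul2l U0).
  have E1 : n ^ k.+1 * #|X| = n * (n ^ k * #|X|) by rewrite expnS mulnA.
  have : n * #|D| <= n * (n ^ k * #|X|) by rewrite leq_mul2l [n ^ k * _]mulnC Dle orbT.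
  have : q * \sum_(e in X) #|cliques G k.+1 (S e)| <= q * \sum_(p in D) #|A p|.
    by rewrite leq_mul2l sumA orbT.
  move: dense H; rewrite E1; set s1 := \sum_(_ in _) _; set s2 := \sum_(_ in _) _.
  nia.
pose J := [set g : {ffun V -> U} | injectiveb g].
pose c (g : {ffun V -> U}) := #|[set p in D | [forall w, g w \in A p]]|.
pose B := (4 * q) ^ t * (2 * q).
have sumc : n ^ k * #|X| * n ^ t <= B * \sum_(g in J) c g.
  have -> : \sum_(g in J) c g = \sum_(p in D) #|A p| ^_ t.
    rewrite -[RHS](eq_bigr _ (fun p _ => card_inj_ffuns_on V (mem (A p)))).
    rewrite -(card_pairs J (fun g => [set p in D | [forall w, g w \in A p]])).
    rewrite -card_pairs.
    apply/eqP; rewrite eqn_leq; apply/andP; split;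
      apply: (@leq_card_map _ _ _ _ (fun p => (p.2, p.1)));
      try by move=> [a b] [a' b'] _ _ [-> ->].
      case=> g p; rewrite [X in is_true X -> _]in_set [X in _ -> is_true X]in_set /=.
      rewrite !in_set => /andP[-> /andP[-> /forallP gA]]; rewrite andbT.
      by apply/ffun_onP => w; apply: gA.
    case=> p g; rewrite [X in is_true X -> _]in_set [X in _ -> is_true X]in_set /=.
    rewrite !in_set => /andP[-> /andP[/ffun_onP gA ->]]; rewrite /=.
    by apply/forallP => w; apply: gA.
  apply: leq_trans (_ : 2 * q * #|D'| * n ^ t <= _); first by rewrite leq_mul2r D'ge orbT.
  rewrite /B [_ * (2 * q)]mulnC -!mulnA !leq_mul2l; apply/orP; right; apply/orP; right.
  rewrite -sum_nat_const big_distrr /= [leqRHS](big_setID D') /= (setIidPr _); last first.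
    by apply/subsetP => p /setIdP[].
  apply: leq_trans (leq_addr _ _); apply: leq_sum => p; rewrite inE => /andP[_ pA].
  apply: leq_trans (leq_mul (leqnn _) (exp_leq_ffact _ _)).
  by rewrite -expnMn; apply: leq_expl; rewrite mulnBr; nia.
have n0 m : 0 < n ^ m by rewrite expn_gt0 U0.
have J0 : 0 < #|J|.
  rewrite card_gt0; apply/eqP => J0; move: sumc; rewrite J0 big_set0 muln0 leqNgt.
  by rewrite !muln_gt0 !n0 X0.
have [|g gJ cg] := @exists_sum_ge _ J (fun g => B * c g) (n ^ k * #|X|) J0.
  rewrite -big_distrr; apply: leq_trans sumc; rewrite leq_mul2l; apply/orP; right.
  by apply: leq_trans (max_card _) _; rewrite card_ffun.
exists g; split; first by move: gJ; rewrite inE => /injectiveP.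
apply: leq_trans cg _; rewrite leq_mul2l; apply/orP; right.
rewrite -card_pairs; apply: subset_leq_card; apply/subsetP => -[e P].
rewrite !in_set /= => /andP[/andP[eX /and3P[PS Pk cP]] /forallP gA].
have gA' w : g w \in S e /\ P \subset nbhd G (g w).
  by have := gA w; rewrite inE => /andP[].
rewrite eX /=; apply/andP; split; first by apply/forallP => w; case: (gA' w).
rewrite Pk cP subsetI PS !andbT /=; apply/subsetP => u uP; rewrite inE.
by apply/forallP => w; case: (gA' w) => _ /subsetP /(_ u uP); rewrite inE.
Qed.

(* A copy of the complete k-partite graph whose parts are all indexed by V, so
   that a proper colouring c of a graph on V embeds it by x |-> Q (c x) x. *)
Definition blowup (V U : finType) (G : sgraph U) k (Q : 'I_k -> V -> U) :=
  (forall i, injective (Q i)) /\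
  (forall i j w w', i != j -> adj G (Q i w) (Q j w')).

Definition add_part (V U : finType) k (g : V -> U) (Q : 'I_k -> V -> U) (i : 'I_k.+1) :=
  if unlift ord0 i is Some j then Q j else g.

Lemma blowup_add_part (V U : finType) (G : sgraph U) k (g : V -> U) (Q : 'I_k -> V -> U) :
  injective g -> (forall w j w', adj G (g w) (Q j w')) -> blowup G Q ->
  blowup G (add_part g Q).
Proof.
move=> gi gQ [Qi Qa]; rewrite /add_part; split=> [i|i j w w'].
  by case: (unliftP ord0 i).
case: (unliftP ord0 i) => [i'|] ->; case: (unliftP ord0 j) => [j'|] ->;
  rewrite ?eqxx //; last by rewrite adj_sym.
by rewrite (inj_eq lift_inj); apply: Qa.
Qed.

Lemma pick_blowup (V : finType) (k q : nat) : exists q' n0 : nat,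
  forall (U : finType) (G : sgraph U) (E : finType) (X : {set E})
    (S : E -> {set U}),
  n0 <= #|U| -> 0 < #|X| ->
  #|U| ^ k * #|X| <= q * \sum_(e in X) #|cliques G k (S e)| ->
  exists Q : 'I_k -> V -> U, blowup G Q /\
    #|X| <= q' * #|[set e in X | [forall i, forall w, Q i w \in S e]]|.
Proof.
elim: k q => [|k IH] q.
  exists 1, 0 => U G E X S _ X0 _; exists (fun i : 'I_0 => False_rect _ (notF (ltn_ord i))).
  split; first by split=> [[]|[]].
  rewrite mul1n; apply: subset_leq_card; apply/subsetP => e eX.
  by rewrite inE eX; apply/forallP => -[].
have [q' [n0 IHq]] := IH ((4 * q) ^ #|V| * (2 * q)).
exists ((4 * q) ^ #|V| * (2 * q) * q'), (maxn n0 (4 * q * #|V|).+1).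
move=> U G E X S; rewrite geq_max => /andP[Un0 Uq] X0 dense.
have U0 : 0 < #|U| by apply: leq_trans Uq.
have [g [ginj gdense]] := @pick_part V U G E X S k q U0 (ltnW Uq) X0 dense.
move: gdense; set X' := [set e in X | _]; set q1 := _ * (2 * q) => gdense.
have XX' : #|X| <= q1 * #|X'|.
  rewrite -(@leq_pmul2l (#|U| ^ k)) ?expn_gt0 ?U0 //; apply: leq_trans gdense _.
  rewrite mulnCA leq_mul2l mulnC sum_leq_card ?orbT // => e _; exact: card_cliques.
have X'0 : 0 < #|X'| by rewrite lt0n; apply/eqP => X'0; rewrite X'0 muln0 in XX'; lia.
have X'X : #|X'| <= #|X| by apply: subset_leq_card; apply/subsetP => e /setIdP[].
have [|Q [[Qinj Qadj] Qdense]] := IHq U G E X'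
  (fun e => S e :&: [set u | [forall w, adj G (g w) u]]) Un0 X'0.
  by apply: leq_trans gdense; rewrite leq_mul2l X'X orbT.
have /card_gt0P[e0] : 0 < #|[set e in X' | [forall i, forall w, Q i w
      \in S e :&: [set u | [forall w, adj G (g w) u]]]]|.
  by rewrite lt0n; apply/eqP => Z; rewrite Z muln0 in Qdense; lia.
rewrite inE => /andP[_ /forallP Qe0].
have gQ w j w' : adj G (g w) (Q j w').
  by have /forallP/(_ w') := Qe0 j; rewrite in_setI => /andP[_]; rewrite in_set => /forallP.
exists (add_part g Q); split; first exact: blowup_add_part.
apply: leq_trans XX' _; rewrite -mulnA leq_mul2l; apply/orP; right.
apply: leq_trans Qdense _; rewrite leq_mul2l; apply/orP; right.
apply: subset_leq_card; apply/subsetP => e; rewrite [X in is_true X -> _]in_set.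
case/andP=> /setIdP[eX /forallP ge] /forallP Qe.
rewrite inE eX; apply/forallP => i; apply/forallP => w.
rewrite /add_part; case: (unliftP ord0 i) => [j|] // _.
by have /forallP/(_ w) := Qe j; rewrite in_setI => /andP[].
Qed.

(** * Conflicts are rare *)

Lemma few_misses (x y z : bool) a b : ~~ x + ~~ y + ~~ z + a + b < 3 ->
  [|| x && (a == 0), z && (a == 0), y && (b == 0) | z && (b == 0)] ||
  [&& x, y, z, a == 1 & b == 1].
Proof. by case: a b x y z => [|[|a]] [|[|b]] [] [] [] //=; lia. Qed.

Section Conflicts.
Variables (U : finType) (G : sgraph U).
Implicit Types (S P Q Z : {set U}) (x y z u v : U).
Notation N := (nbhd G).
Notation n := #|U|.

(* Conflicts ((x, y, z), (P, Q)): x ~ y, while P and Q are joined to both ends of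
   the pairs x, z and y, z. *)
Definition conf k S : {set (U * U * U) * ({set U} * {set U})} :=
  [set W | let: ((x, y, z), (P, Q)) := W in
    [&& x \in S, y \in S, z \in S, adj G x y,
        P \in cliques G k (S :&: N x :&: N z) &
        Q \in cliques G k (S :&: N y :&: N z)]].

Lemma in_conf k S x y z P Q : ((x, y, z), (P, Q)) \in conf k S =
  [&& [&& x \in S, y \in S & z \in S], adj G x y,
      P \in cliques G k (S :&: N x :&: N z) &
      Q \in cliques G k (S :&: N y :&: N z)].
Proof. by rewrite [LHS]in_set -!andbA. Qed.

Lemma sum_miss S P M : (forall u, #|~: N u| <= M) ->
  \sum_(v in S) #|P :\: N v| <= #|P| * M.
Proof.
move=> miss; rewrite -card_pairs.
apply: leq_trans (_ : \sum_(p in P) #|~: N p| <= _); last exact: sum_leq_card.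
rewrite -card_pairs.
apply: (@leq_card_map _ _ _ _ (fun p => (p.2, p.1))) => [[u p] [v q] _ _ [-> ->] //|[v p]].
rewrite [X in is_true X -> _]in_set [X in _ -> is_true X]in_set /= in_setD in_setC.
by rewrite nbhdC => /andP[_ /andP[-> ->]].
Qed.

Lemma cards1D u S : #|[set u] :\: S| = (u \notin S).
Proof.
case: (boolP (u \in S)) => uS /=.
  by apply/eqP; rewrite cards_eq0 setD_eq0 sub1set.
by rewrite (setDidPl _) ?cards1 // disjoints1.
Qed.

Definition ext k S : {set (U * U) * {set U}} :=
  [set p | [&& p.1.1 \in S, p.1.2 \in S :&: N p.1.1 &
     p.2 \in cliques G k (S :&: N p.1.1 :&: N p.1.2)]].

Lemma in_ext k S v x P : ((v, x), P) \in ext k S =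
  [&& v \in S, x \in S :&: N v & P \in cliques G k (S :&: N v :&: N x)].
Proof. by rewrite [LHS]in_set. Qed.

Lemma card_ext k S : #|ext k S| = k.+2 * (k.+1 * #|cliques G k.+2 S|).
Proof.
have -> : ext k S = [set p | (p.1 \in [set q : U * U | (q.1 \in S) &&
    (q.2 \in S :&: N q.1)]) && (p.2 \in cliques G k (S :&: N p.1.1 :&: N p.1.2))].
  by apply/setP => -[[v x] P]; rewrite !in_set /= -!andbA.
rewrite (card_pairs _ (fun q => cliques G k (S :&: N q.1 :&: N q.2))).
transitivity (\sum_(v in S) \sum_(x in S :&: N v) #|cliques G k (S :&: N v :&: N x)|).
  by rewrite pair_big_dep /=; apply: eq_bigl => p; rewrite inE.
under eq_bigr do rewrite sum_cliques_link.
by rewrite -big_distrr /= sum_cliques_link mulnCA.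
Qed.

Lemma card_conf0 S : #|conf 0 S| <= 2 * n * #|cliques G 2 S|.
Proof.
rewrite [2 * n]mulnC -mulnA; have := card_ext 0 S; rewrite mul1n => <-.
rewrite -cardsT -cardsX.
apply: (@leq_card_map _ _ _ _ (fun W => (W.1.2, ((W.1.1.1, W.1.1.2), set0)))).
  move=> [[[x y] z] [P Q]] [[[x' y'] z'] [P' Q']]; rewrite !in_conf.
  case/and4P=> _ _ /cliquesP[_ /cards0_eq -> _] /cliquesP[_ /cards0_eq -> _].
  case/and4P=> _ _ /cliquesP[_ /cards0_eq -> _] /cliquesP[_ /cards0_eq -> _].
  by case=> -> -> ->.
move=> [[[x y] z] [P Q]]; rewrite in_conf => /and4P[/and3P[xS yS _] xy _ _].
rewrite in_setX in_setT in_set /= in_setI in_nbhd xS yS xy.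
apply/cliquesP; rewrite sub0set cards0; split=> //.
by apply/cliqueP => u; rewrite inE.
Qed.

Lemma conf_low k S x y z P Q v :
  ((x, y, z), (P, Q)) \in conf k.+1 S -> v \in S ->
  #|[set x] :\: N v| + #|[set y] :\: N v| + #|[set z] :\: N v| +
    #|P :\: N v| + #|Q :\: N v| < 3 ->
  [|| (x \in N v) && (P \subset N v), (z \in N v) && (P \subset N v),
      (y \in N v) && (Q \subset N v), (z \in N v) && (Q \subset N v) |
      [exists p in P, exists q in Q,
         ((x, y, z), (P :\ p, Q :\ q)) \in conf k (S :&: N v)]].
Proof.
rewrite in_conf => /and4P[/and3P[xS yS zS] xy PK QK] vS.
rewrite !cards1D -!setD_eq0 -!cards_eq0.
move/few_misses/orP => [|/and5P[xv yv zv /cards1P[p Pp] /cards1P[q Qq]]].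
  by case/or4P=> ->; rewrite ?orbT.
apply/orP; right; apply/orP; right; apply/orP; right; apply/orP; right.
have [pP pv] : p \in P /\ p \notin N v.
  by have := set11 p; rewrite -Pp inE => /andP[].
have [qQ qv] : q \in Q /\ q \notin N v.
  by have := set11 q; rewrite -Qq inE => /andP[].
apply/exists_inP; exists p => //; apply/exists_inP; exists q => //.
have sub (R : {set U}) r S' : R \in cliques G k.+1 (S :&: S') -> r \in R ->
    R :\: N v = [set r] -> R :\ r \in cliques G k (S :&: N v :&: S').
  move=> RK rR Rr; have /cliquesP[RS Rk cR] := cliquesD1 RK rR.
  apply/cliquesP; split=> //; apply/subsetP => w wR; move: (subsetP RS w wR).
  rewrite !in_setI => /andP[/andP[-> ->] _]; rewrite andbT /=.
  apply: contraLR wR => wv; rewrite in_setD1 negb_and negbK.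
  case wR: (w \in R); rewrite ?orbT // orbF.
  by rewrite -in_set1 -Rr in_setD wv.
rewrite in_conf !in_setI xS yS zS xv yv zv xy /=; apply/andP; split.
  by rewrite -setIA; apply: sub => //; rewrite setIA.
by rewrite -setIA; apply: sub => //; rewrite setIA.
Qed.

Lemma conf_extend k S (pt : (U * U * U) * ({set U} * {set U}) -> U)
    (cl : (U * U * U) * ({set U} * {set U}) -> {set U})
    (rest : (U * U * U) * ({set U} * {set U}) -> U * U * {set U}) :
  injective (fun W => (pt W, cl W, rest W)) ->
  (forall W, W \in conf k.+1 S -> [/\ pt W \in S,
     cl W \in cliques G k.+1 (S :&: N (pt W)) & (rest W).2 \in cliques G k.+1 setT]) ->
  #|[set p | (p.1 \in conf k.+1 S) &&
     (p.2 \in [set v in S | (pt p.1 \in N v) && (cl p.1 \subset N v)])]| <=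
  k.+3 * (k.+2 * #|cliques G k.+3 S|) * n ^ k.+3.
Proof.
move=> inj ok; rewrite -card_ext.
apply: leq_trans (_ : _ <= #|setX (ext k.+1 S) (setX setT (cliques G k.+1 setT))|) _.
  apply: (@leq_card_map _ _ _ _ (fun p => ((p.2, pt p.1, cl p.1), rest p.1))).
    by move=> [W v] [W' v'] _ _ /= [-> e1 e2 e3]; congr (_, _); apply: inj; rewrite e1 e2 e3.
  move=> [W v]; rewrite [X in is_true X -> _]in_set /= => /andP[WK].
  rewrite in_set => /and3P[vS ptv clv]; have [ptS clK restK] := ok W WK.
  rewrite in_setX /= in_ext vS in_setI ptS ptv /=; apply/andP; split; last first.
    by case: (rest W) restK => a b /=; rewrite in_setX in_setT.
  case/cliquesP: clK; rewrite subsetI => /andP[clS clN] clk cK.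
  by apply/cliquesP; rewrite !subsetI clS clN clv.
rewrite !cardsX cardsT card_prod leq_mul2l; apply/orP; right.
by rewrite [n ^ k.+3]expnS [n ^ k.+2]expnS mulnA leq_mul2l card_cliques orbT.
Qed.

Lemma conf_link k S :
  #|[set p | (p.1 \in conf k.+1 S) && (p.2 \in [set v in S |
     [exists p' in p.1.2.1, exists q' in p.1.2.2,
        (p.1.1, (p.1.2.1 :\ p', p.1.2.2 :\ q')) \in conf k (S :&: N v)]])]| <=
  n ^ 2 * \sum_(v in S) #|conf k (S :&: N v)|.
Proof.
rewrite -card_pairs -mulnn -card_prod -cardsT -cardsX.
pose pq (W : (U * U * U) * ({set U} * {set U})) v : U * U :=
  odflt (v, v) [pick pq : U * U | [&& pq.1 \in W.2.1, pq.2 \in W.2.2 &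
    (W.1, (W.2.1 :\ pq.1, W.2.2 :\ pq.2)) \in conf k (S :&: N v)]].
have pqP (W : (U * U * U) * ({set U} * {set U})) v : [exists p' in W.2.1, exists q' in W.2.2,
        (W.1, (W.2.1 :\ p', W.2.2 :\ q')) \in conf k (S :&: N v)] ->
    [&& (pq W v).1 \in W.2.1, (pq W v).2 \in W.2.2 &
      (W.1, (W.2.1 :\ (pq W v).1, W.2.2 :\ (pq W v).2)) \in conf k (S :&: N v)].
  case/exists_inP=> p' p'P /exists_inP[q' q'Q Wc]; rewrite /pq.
  by case: pickP => [//|/(_ (p', q'))]; rewrite /= p'P q'Q Wc.
apply: (@leq_card_map _ _ _ _ (fun p => (pq p.1 p.2,
   (p.2, (p.1.1, (p.1.2.1 :\ (pq p.1 p.2).1, p.1.2.2 :\ (pq p.1 p.2).2)))))).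
  move=> [[T [P Q]] v] [[T' [P' Q']] v'].
  rewrite [X in is_true X -> _]in_set /= => /andP[_ /setIdP[_ /= /(pqP (_, (_, _))) /=]].
  move: (pq _ v) => a /and3P[aP aQ _].
  rewrite [X in is_true X -> _]in_set /= => /andP[_ /setIdP[_ /= /(pqP (_, (_, _))) /=]].
  move: (pq _ v') => a' /and3P[aP' aQ' _].
  case=> eqa -> -> eP eQ; congr (_, (_, _), _).
    by rewrite -(setD1K aP) eP eqa setD1K.
  by rewrite -(setD1K aQ) eQ eqa setD1K.
move=> [W v]; rewrite [X in is_true X -> _]in_set /= => /andP[_].
rewrite in_set => /andP[vS /pqP /and3P[_ _ Wc]].
by rewrite in_setX in_setT [X in is_true X]in_set /= vS.
Qed.

Lemma conf_step k S M e : (forall u, #|~: N u| <= M) ->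
  (3 * k.+1 + 2) * M + e <= 3 * #|S| ->
  e * #|conf k.+1 S| <= 3 * (4 * (k.+3 * (k.+2 * #|cliques G k.+3 S|) * n ^ k.+3) +
    n ^ 2 * \sum_(v in S) #|conf k (S :&: N v)|).
Proof.
move=> miss dense.
pose w (W : (U * U * U) * ({set U} * {set U})) v :=
  #|[set W.1.1.1] :\: N v| + #|[set W.1.1.2] :\: N v| + #|[set W.1.2] :\: N v| +
  #|W.2.1 :\: N v| + #|W.2.2 :\: N v|.
have lowe W : W \in conf k.+1 S -> e <= 3 * #|[set v in S | w W v < 3]|.
  move=> WK; have /(card_low 3) : \sum_(v in S) w W v <= (3 + 2 * k.+1) * M.
    case: W WK => [[[x y] z] [P Q]]; rewrite in_conf => /and4P[_ _].
    move=> /cliquesP[_ Pk _] /cliquesP[_ Qk _].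
    rewrite !big_split /=; have sm := sum_miss S _ miss.
    apply: leq_trans (_ : _ <= #|[set x]| * M + #|[set y]| * M + #|[set z]| * M
      + #|P| * M + #|Q| * M) _; first by rewrite !leq_add.
    by rewrite !cards1 Pk Qk -!mulnDl leq_mul2r; apply/orP; right; lia.
  move: dense; set l := #|[set v in S | _]|; set s := #|S|; nia.
have [L] : {L | L = [set p | (p.1 \in conf k.+1 S) &&
    (p.2 \in [set v in S | w p.1 v < 3])]} by eexists.
move=> LE; apply: leq_trans (_ : 3 * #|L| <= _).
  rewrite LE (card_pairs (conf k.+1 S) (fun W => [set v in S | w W v < 3])).
  rewrite big_distrr /= mulnC -sum_nat_const; exact: leq_sum.
rewrite leq_mul2l /=.
pose L' (pt : (U * U * U) * ({set U} * {set U}) -> U)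
    (cl : (U * U * U) * ({set U} * {set U}) -> {set U}) :=
  [set p | (p.1 \in conf k.+1 S) &&
     (p.2 \in [set v in S | (pt p.1 \in N v) && (cl p.1 \subset N v)])].
pose L1 := L' (fun W => W.1.1.1) (fun W => W.2.1).
pose L2 := L' (fun W => W.1.2) (fun W => W.2.1).
pose L3 := L' (fun W => W.1.1.2) (fun W => W.2.2).
pose L4 := L' (fun W => W.1.2) (fun W => W.2.2).
pose L5 := [set p | (p.1 \in conf k.+1 S) && (p.2 \in [set v in S |
     [exists p' in p.1.2.1, exists q' in p.1.2.2,
        (p.1.1, (p.1.2.1 :\ p', p.1.2.2 :\ q')) \in conf k (S :&: N v)]])].
have sub : L \subset L1 :|: L2 :|: L3 :|: L4 :|: L5.
  apply/subsetP => -[[[[x y] z] [P Q]] v]; rewrite LE [X in is_true X -> _]in_set /= in_set.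
  case/and3P=> WK vS /(conf_low WK vS) H.
  have E pt cl : (((x, y, z), (P, Q)), v) \in L' pt cl =
      (pt ((x, y, z), (P, Q)) \in N v) && (cl ((x, y, z), (P, Q)) \subset N v).
    by rewrite [LHS]in_set /= WK [LHS]in_set vS.
  have E5 : (((x, y, z), (P, Q)), v) \in L5 = [exists p' in P, exists q' in Q,
      ((x, y, z), (P :\ p', Q :\ q')) \in conf k (S :&: N v)].
    by rewrite [LHS]in_set /= WK [LHS]in_set vS.
  by rewrite !in_setU /L1 /L2 /L3 /L4 !E E5 -!orbA.
apply: leq_trans (subset_leq_card sub) _.
apply: leq_trans (leq_card_setU _ _) _; apply: leq_add; last exact: conf_link.
have bd pt cl rest := @conf_extend k S pt cl rest.
have l1 : #|L1| <= k.+3 * (k.+2 * #|cliques G k.+3 S|) * n ^ k.+3.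
  apply: (bd _ _ (fun W => (W.1.1.2, W.1.2, W.2.2))).
    by move=> [[[x y] z] [P Q]] [[[x' y'] z'] [P' Q']] /= [-> -> -> -> ->].
  move=> [[[x y] z] [P Q]]; rewrite in_conf => /and4P[/and3P[xS yS zS] xy PK QK].
  split=> //=; first by apply: subsetP PK; rewrite cliquesS ?subsetIl.
  by apply: subsetP QK; rewrite cliquesS ?subsetT.
have l2 : #|L2| <= k.+3 * (k.+2 * #|cliques G k.+3 S|) * n ^ k.+3.
  apply: (bd _ _ (fun W => (W.1.1.1, W.1.1.2, W.2.2))).
    by move=> [[[x y] z] [P Q]] [[[x' y'] z'] [P' Q']] /= [-> -> -> -> ->].
  move=> [[[x y] z] [P Q]]; rewrite in_conf => /and4P[/and3P[xS yS zS] xy PK QK].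
  split=> //=; first by apply: subsetP PK; rewrite cliquesS // setIAC subsetIl.
  by apply: subsetP QK; rewrite cliquesS ?subsetT.
have l3 : #|L3| <= k.+3 * (k.+2 * #|cliques G k.+3 S|) * n ^ k.+3.
  apply: (bd _ _ (fun W => (W.1.1.1, W.1.2, W.2.1))).
    by move=> [[[x y] z] [P Q]] [[[x' y'] z'] [P' Q']] /= [-> -> -> -> ->].
  move=> [[[x y] z] [P Q]]; rewrite in_conf => /and4P[/and3P[xS yS zS] xy PK QK].
  split=> //=; first by apply: subsetP QK; rewrite cliquesS ?subsetIl.
  by apply: subsetP PK; rewrite cliquesS ?subsetT.
have l4 : #|L4| <= k.+3 * (k.+2 * #|cliques G k.+3 S|) * n ^ k.+3.
  apply: (bd _ _ (fun W => (W.1.1.1, W.1.1.2, W.2.1))).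
    by move=> [[[x y] z] [P Q]] [[[x' y'] z'] [P' Q']] /= [-> -> -> -> ->].
  move=> [[[x y] z] [P Q]]; rewrite in_conf => /and4P[/and3P[xS yS zS] xy PK QK].
  split=> //=; first by apply: subsetP QK; rewrite cliquesS // setIAC subsetIl.
  by apply: subsetP PK; rewrite cliquesS ?subsetT.
apply: leq_trans (leq_card_setU _ _) _.
apply: leq_trans (leq_add (leq_card_setU _ _) l4) _.
apply: leq_trans (leq_add (leq_add (leq_card_setU _ _) l3) (leqnn _)) _.
by move: l1 l2; move: (_ * n ^ k.+3) => b l1 l2; lia.
Qed.

End Conflicts.

Lemma card_conf k : exists C, forall (U : finType) (G : sgraph U) (S : {set U}) M e,
  (forall u, #|~: nbhd G u| <= M) -> (3 * k + 2) * M + e <= 3 * #|S| ->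
  e ^ k * #|conf G k S| <= C * #|U| ^ (2 * k).+1 * #|cliques G k.+2 S|.
Proof.
elim: k => [|k [C IH]].
  by exists 2 => U G S M e _ _; rewrite mul1n expn1 card_conf0.
exists (3 * (4 * (k.+3 * k.+2) * 3 ^ k + C * k.+3)) => U G S M e miss dense.
set n := #|U|; have Sn : #|S| <= n by exact: max_card.
have h1 : e ^ k * n ^ k.+3 <= 3 ^ k * n ^ (2 * k.+1).+1.
  have -> : (2 * k.+1).+1 = k + k.+3 by lia.
  rewrite expnD mulnA leq_mul2r -expnMn leq_expl ?orbT //; lia.
have h2 : e ^ k * \sum_(v in S) #|conf G k (S :&: nbhd G v)| <=
    C * n ^ (2 * k).+1 * (k.+3 * #|cliques G k.+3 S|).
  rewrite -sum_cliques_link !big_distrr /=; apply: leq_sum => v vS.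
  apply: (IH _ _ _ M) => //.
  have : #|S| <= #|S :&: nbhd G v| + M.
    rewrite -(cardsID (nbhd G v) S) leq_add2l; apply: leq_trans (miss v).
    by apply: subset_leq_card; rewrite setDE subsetIr.
  lia.
have n2 : n ^ 2 * n ^ (2 * k).+1 = n ^ (2 * k.+1).+1.
  by rewrite -expnD; congr (_ ^ _); lia.
have := leq_mul (leqnn (e ^ k)) (conf_step miss dense); rewrite mulnA -expnSr.
move/leq_trans; apply; rewrite -/n.
move: h1 h2 n2; move: (\sum_(v in S) _) (e ^ k) (n ^ 2) (3 ^ k)
  (n ^ (2 * k).+1) (n ^ (2 * k.+1).+1) => s E n2 t m1 m2.
move: k.+2 (k.+3) (n ^ k.+3) #|cliques G k.+3 S| => b a n3 K h1 h2 nE.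
have -> : E * (3 * (4 * (a * (b * K) * n3) + n2 * s)) =
  3 * (4 * (a * (b * K)) * (E * n3) + n2 * (E * s)) by lia.
have -> : 3 * (4 * (a * b) * t + C * a) * m2 * K =
  3 * (4 * (a * (b * K)) * (t * m2) + n2 * (C * m1 * (a * K))).
  by rewrite -nE; lia.
by rewrite leq_mul2l leq_add ?leq_mul2l ?h1 ?h2 ?orbT.
Qed.

(** * Most vertices are alike to a vertex of a given clique *)

Section Isolated.
Variables (U : finType) (G : sgraph U).
Implicit Types (S P Q Z : {set U}) (x y z u v : U).
Notation N := (nbhd G).
Notation n := #|U|.

Definition alike k c x z := n ^ k < c * #|cliques G k (N x :&: N z)|.

Definition isolated k c : {set {set U} * U} :=
  [set p | (p.1 \in cliques G k.+1 setT) &&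
    [forall z in p.1 :\: N p.2, ~~ alike k c p.2 z]].

(* Exchanging a vertex of Z for a neighbour of x raises the third index by one. *)
Definition isolated_at k c j := [set p in isolated k c | #|p.1 :&: N p.2| == j].

Lemma in_isolated k c Z x : ((Z, x) \in isolated k c) =
  (Z \in cliques G k.+1 setT) && [forall z in Z :\: N x, ~~ alike k c x z].
Proof. by rewrite [LHS]in_set. Qed.

Lemma in_isolated_at k c j Z x : ((Z, x) \in isolated_at k c j) =
  ((Z, x) \in isolated k c) && (#|Z :&: N x| == j).
Proof. by rewrite [LHS]in_set. Qed.

Lemma card_cone k :
  #|[set p : U * {set U} | (p.1 \in [set: U]) && (p.2 \in cliques G k.+1 (setT :&: N p.1))]|
    = k.+2 * #|cliques G k.+2 setT|.
Proof.
by rewrite (card_pairs setT (fun u => cliques G k.+1 (setT :&: N u))) sum_cliques_link.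
Qed.

Lemma card_isolated_all k c : #|isolated_at k c k.+1| <= k.+2 * #|cliques G k.+2 setT|.
Proof.
rewrite -card_cone.
apply: (@leq_card_map _ _ _ _ (fun p => (p.2, p.1))) => [[Z x] [Z' x'] _ _ [-> ->] //|[Z x]].
rewrite in_isolated_at in_isolated => /andP[/andP[/cliquesP[_ Zk cZ] _] /eqP Zx].
rewrite [X in is_true X]in_set /= in_setT setTI; apply/cliquesP; split=> //.
have /eqP <- : Z :&: N x == Z by rewrite eqEcard subsetIl Zx Zk leqnn.
exact: subsetIr.
Qed.

Lemma card_isolated_one k c : c * #|isolated_at k c k| <= n ^ k.+2.
Proof.
pose B := [set p : U * U | ~~ alike k c p.1 p.2].
apply: leq_trans (_ : c * \sum_(p in B) #|cliques G k (N p.1 :&: N p.2)| <= _).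
  rewrite leq_mul2l; apply/orP; right.
  rewrite -(card_pairs B (fun p => cliques G k (N p.1 :&: N p.2))).
  pose z (p : {set U} * U) := odflt p.2 [pick u in p.1 :\: N p.2].
  have zP p : p \in isolated_at k c k -> p.1 :\: N p.2 = [set z p].
    case: p => Z x; rewrite in_isolated_at in_isolated /=.
    case/andP=> /andP[/cliquesP[_ Zk _] _] /eqP Zx.
    have /eqP/cards1P[u Zu] : #|Z :\: N x| = 1 by have := cardsID (N x) Z; lia.
    rewrite /z /= Zu; case: pickP => [w|/(_ u)]; last by rewrite inE eqxx.
    by rewrite inE => /eqP->.
  apply: (@leq_card_map _ _ _ _ (fun p => ((p.2, z p), p.1 :\ z p))).
    move=> [Z x] [Z' x'] Zx Zx' [ex ez eZ]; subst x'; congr (_, _).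
    have zZ : z (Z, x) \in Z by have := set11 (z (Z, x)); rewrite -zP // inE => /andP[].
    have zZ' : z (Z', x) \in Z' by have := set11 (z (Z', x)); rewrite -zP // inE => /andP[].
    by rewrite -(setD1K zZ) eZ ez setD1K.
  move=> [Z x] Zx; have := zP _ Zx; set u := z _ => /= Zu.
  have uZ : u \in Z :\: N x by rewrite Zu set11.
  move: Zx; rewrite in_isolated_at in_isolated => /andP[/andP[ZK /forall_inP/(_ u uZ) sxu] _].
  rewrite [X in is_true X]in_set /= [X in X && _]in_set sxu /=.
  move: uZ; rewrite in_setD => /andP[_ uZ].
  have /cliquesP[] := cliquesD1 ZK uZ; rewrite setTI => ZuN Zk cZ; apply/cliquesP; split=> //.
  rewrite subsetI ZuN andbT; apply/subsetP => w; rewrite in_setD1 => /andP[wu wZ].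
  by apply: contraR wu => wx; rewrite -in_set1 -Zu in_setD wx.
rewrite big_distrr /=; apply: leq_trans (sum_leq_card _) (_ : #|B| * n ^ k <= _).
  by move=> p; rewrite inE -leqNgt.
by rewrite -addn2 addnC expnD leq_mul2r -mulnn -card_prod max_card orbT.
Qed.

Lemma isolated_step k c M j : (forall u, #|~: N u| <= M) ->
  (3 * k + 2) * M <= 3 * n -> j < k ->
  #|isolated_at k c j| <= (6 * k + 4) *
    (k.+2 * #|cliques G k.+2 setT| + k.+1 * #|isolated_at k c j.+1|).
Proof.
move=> miss dense jk.
case: (posnP n) => [n0|n0].
  rewrite [leqLHS]eq_card0 // => -[Z x]; suff: 0 < n by rewrite n0.
  by apply/card_gt0P; exists x.
rewrite -(leq_pmul2l n0).
pose w (p : {set U} * U) v := #|(p.1 :&: N p.2) :\: N v| + #|(p.1 :&: N p.2) :\: N v| +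
  #|(p.1 :\: N p.2) :\: N v| + #|[set p.2] :\: N v|.
have low p : p \in isolated_at k c j ->
    n <= (6 * k + 4) * #|[set v in [set: U] | w p v < 2]|.
  case: p => Z x; rewrite in_isolated_at in_isolated.
  case/andP=> /andP[/cliquesP[_ Zk _] _] /eqP Zx.
  have /(card_low 2) : \sum_(v in [set: U]) w (Z, x) v <= (2 * k + 1) * M.
    rewrite !big_split /=; have sm := sum_miss setT _ miss.
    apply: leq_trans (_ : _ <= #|Z :&: N x| * M + #|Z :&: N x| * M +
      #|Z :\: N x| * M + #|[set x]| * M) _; first by rewrite !leq_add.
    rewrite cards1 -!mulnDl leq_mul2r; apply/orP; right.
    by have := cardsID (N x) Z; lia.
  rewrite cardsT; move: dense; move: #|[set v in _ | _]| => l.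
  nia.
pose L := [set p | (p.1 \in isolated_at k c j) &&
    (p.2 \in [set v in [set: U] | w p.1 v < 2])].
apply: leq_trans (_ : (6 * k + 4) * #|L| <= _).
  rewrite (card_pairs (isolated_at k c j) (fun p => [set v in [set: U] | w p v < 2])).
  rewrite big_distrr /= mulnC -sum_nat_const; exact: leq_sum.
rewrite mulnCA leq_mul2l; apply/orP; right.
pose L1 := [set p | (p.1 \in isolated_at k c j) && (p.2 \in [set v | p.1.1 \subset N v])].
pose L2 := [set p | (p.1 \in isolated_at k c j) && (p.2 \in [set v in N p.1.2 |
  [exists z in p.1.1, (z \notin N p.1.2) && ((v \notin p.1.1) &&
     ((v |: p.1.1 :\ z, p.1.2) \in isolated_at k c j.+1))]])].
have sub : L \subset L1 :|: L2.
  apply/subsetP => -[[Z x] v].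
  rewrite [X in is_true X -> _]in_set => /andP[Zx /setIdP[_]].
  rewrite /w /= cards1D => low2.
  rewrite in_setU [X in X || _]in_set /= Zx [X in X || _]in_set -implyNb.
  apply/implyP => Zv.
  have ZD : #|Z :\: N v| = #|(Z :&: N x) :\: N v| + #|(Z :\: N x) :\: N v|.
    by rewrite -(cardsID (N x) (Z :\: N v)); congr (_ + _); apply: eq_card => u;
      rewrite !inE; do ![case: (_ \in _) => //=]; case: adj; case: adj.
  have Z0 : #|Z :\: N v| != 0 by rewrite cards_eq0 setD_eq0.
  have xv : v \in N x by rewrite nbhdC; case: (x \in N v) low2 => //=; lia.
  have Zx0 : #|(Z :&: N x) :\: N v| = 0 by lia.
  have /eqP/cards1P[z Zz] : #|(Z :\: N x) :\: N v| = 1 by lia.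
  have : z \in (Z :\: N x) :\: N v by rewrite Zz set11.
  rewrite !in_setD => /and3P[zv zx zZ].
  have Zsub : Z :\ z \subset N v.
    apply/subsetP => u; rewrite in_setD1 => /andP[uz uZ].
    case ux : (u \in N x).
      move/cards0_eq/setP/(_ u): Zx0.
      by rewrite in_setD in_setI in_set0 uZ ux /= andbT => /negbFE.
    by apply: contraR uz => uv; rewrite -in_set1 -Zz !in_setD uv ux.
  have vZ : v \notin Z.
    apply: contraL (xv) => vZ; suff -> : v = z by [].
    apply/eqP; apply: contraFT (nbhd_irrefl G v) => vz.
    by apply: (subsetP Zsub); rewrite in_setD1 vz.
  rewrite [X in is_true X]in_set /= Zx [X in is_true X]in_set xv /=.
  apply/exists_inP; exists z => //; rewrite zx vZ /=.
  move: Zx; rewrite !in_isolated_at !in_isolated => /andP[/andP[ZK /forall_inP ns] /eqP Zj].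
  have ZK' : v |: Z :\ z \in cliques G k.+1 setT.
    apply: cliquesU1; rewrite ?in_setT // setTI.
    by have /cliquesP[_ Zk cZ] := cliquesD1 ZK zZ; apply/cliquesP.
  rewrite ZK' /=; apply/andP; split.
    apply/forall_inP => u; rewrite in_setD in_setU1 in_setD1 => /andP[ux].
    case/orP=> [/eqP uv|/andP[_ uZ]]; first by rewrite uv xv in ux.
    by apply: ns; rewrite in_setD ux.
  have -> : (v |: Z :\ z) :&: N x = v |: (Z :&: N x).
    apply/setP => u; rewrite !in_setI !in_setU1 in_setD1 in_setI.
    case: eqP => [->|_] //=; case: eqP => [->|_] //=.
    by rewrite (negbTE zx) !andbF.
  by rewrite cardsU1 in_setI (negbTE vZ) /= Zj.
apply: leq_trans (subset_leq_card sub) _; apply: leq_trans (leq_card_setU _ _) _.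
rewrite mulnDr; apply: leq_add.
  rewrite -card_cone -cardsT -cardsX.
  apply: (@leq_card_map _ _ _ _ (fun p => (p.1.2, (p.2, p.1.1)))).
    by move=> [[Z x] v] [[Z' x'] v'] _ _ /= [-> -> ->].
  move=> [[Z x] v]; rewrite [X in is_true X -> _]in_set /= => /andP[].
  rewrite in_isolated_at in_isolated in_set => /andP[/andP[/cliquesP[_ Zk cZ] _] _] Zv.
  rewrite in_setX in_setT [X in is_true X]in_set /= in_setT setTI; exact/cliquesP.
pose F1 := [set p : ({set U} * U) * U | (p.1 \in isolated_at k c j.+1) && (p.2 \in p.1.1)].
have F1le : #|F1| = k.+1 * #|isolated_at k c j.+1|.
  rewrite (card_pairs _ (fun p : {set U} * U => p.1)) mulnC -sum_nat_const.
  apply: eq_bigr => -[Z x]; rewrite in_isolated_at in_isolated.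
  by case/andP=> /andP[/cliquesP[]].
rewrite -F1le -cardsT -cardsX.
pose z (p : ({set U} * U) * U) := odflt p.2 [pick u in p.1.1 | (u \notin N p.1.2) &&
  ((p.2 \notin p.1.1) && ((p.2 |: p.1.1 :\ u, p.1.2) \in isolated_at k c j.+1))].
have zP p : p \in L2 -> [&& z p \in p.1.1, p.2 \notin p.1.1 &
    (p.2 |: p.1.1 :\ z p, p.1.2) \in isolated_at k c j.+1].
  rewrite [X in is_true X -> _]in_set => /andP[_ /setIdP[_ /exists_inP[u uZ uP]]].
  rewrite /z; case: pickP => [u' /and4P[-> _ -> ->] //|/(_ u)].
  by rewrite uZ uP.
apply: (@leq_card_map _ _ _ _ (fun p => (z p, ((p.2 |: p.1.1 :\ z p, p.1.2), p.2)))).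
  move=> [[Z x] v] [[Z' x'] v'] /zP /= + /zP /= +.
  move: (z _) (z _) => a a' /and3P[aZ vZ _] /and3P[aZ' vZ' _] [ea eZ ex ev].
  subst a' x' v'; congr (_, _, _).
  rewrite -(setD1K aZ) -(setD1K aZ'); congr (_ |: _).
  have nv (Y : {set U}) : v \notin Y -> v \notin Y :\ a.
    by apply: contra; rewrite in_setD1 => /andP[].
  by rewrite -(setU1K (nv _ vZ)) eZ setU1K // nv.
move=> [[Z x] v] /zP /= /and3P[_ _ ok].
by rewrite in_setX in_setT [X in is_true X]in_set /= ok setU11.
Qed.

End Isolated.

Lemma card_isolated k : exists A, forall (U : finType) (G : sgraph U) M c,
  (forall u, #|~: nbhd G u| <= M) -> (3 * k + 2) * M <= 3 * #|U| ->
  c * #|isolated G k c| <= A * (c * #|cliques G k.+2 setT| + #|U| ^ k.+2).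
Proof.
have [a aP] : exists a, forall i, i <= k -> forall (U : finType) (G : sgraph U) M c,
    (forall u, #|~: nbhd G u| <= M) -> (3 * k + 2) * M <= 3 * #|U| ->
    c * #|isolated_at G k c (k - i)| <=
      a i * (c * #|cliques G k.+2 setT| + #|U| ^ k.+2).
  pose a := fix a i := if i is i'.+1 then (6 * k + 4) * (k.+2 + k.+1 * a i') else 1.
  have aS i : a i.+1 = (6 * k + 4) * (k.+2 + k.+1 * a i) by [].
  exists a.
  elim=> [_|i IH ik] U G M c miss dense.
    rewrite subn0 mul1n; apply: leq_trans (card_isolated_one _ _ _) _; exact: leq_addl.
  have /(isolated_step c miss dense) : k - i.+1 < k by lia.
  have -> : (k - i.+1).+1 = k - i by lia.
  move=> /(leq_mul (leqnn c)) /leq_trans; apply.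
  have := IH (ltnW ik) U G M c miss dense; rewrite aS.
  move: (a i) #|isolated_at _ _ _ _| #|cliques _ _ _| (#|U| ^ _) (6 * k + 4) => b f K m d.
  move=> h; have -> : c * (d * (k.+2 * K + k.+1 * f)) =
    d * (k.+2 * (c * K) + k.+1 * (c * f)) by lia.
  rewrite -mulnA leq_mul2l; apply/orP; right.
  rewrite mulnDl; apply: leq_add; first by rewrite leq_mul2l leq_addr orbT.
  by rewrite -mulnA leq_mul2l h orbT.
exists (\sum_(i < k.+1) a i + k.+2) => U G M c miss dense.
have sub : isolated G k c \subset
    isolated_at G k c k.+1 :|: \bigcup_(i < k.+1) isolated_at G k c (k - i).
  apply/subsetP => -[Z x] Zx; rewrite in_setU.
  have Zk : #|Z :&: nbhd G x| <= k.+1.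
    move: Zx; rewrite in_isolated => /andP[/cliquesP[_ <- _] _].
    by rewrite subset_leq_card ?subsetIl.
  rewrite in_isolated_at Zx /=; move: Zk; rewrite leq_eqVlt => /orP[-> //|Zk].
  apply/orP; right; apply/bigcupP; exists (inord (k - #|Z :&: nbhd G x|)) => //.
  by rewrite in_isolated_at Zx inordK /=; [apply/eqP|]; lia.
apply: leq_trans (leq_mul (leqnn c) (subset_leq_card sub)) _.
apply: leq_trans (leq_mul (leqnn c) (leq_card_setU _ _)) _.
rewrite mulnDr [_ + k.+2]addnC mulnDl; apply: leq_add.
  apply: leq_trans (leq_mul (leqnn c) (card_isolated_all _ _ _)) _.
  by rewrite mulnCA leq_mul2l leq_addr orbT.
apply: leq_trans (_ : c * \sum_(i < k.+1) #|isolated_at G k c (k - i)| <= _).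
  rewrite leq_mul2l; apply/orP; right.
  elim/big_rec2: _ => [|i s S' _ h]; first by rewrite cards0.
  by apply: leq_trans (leq_card_setU _ _) _; rewrite leq_add2l.
rewrite big_distrr big_distrl /=; apply: leq_sum => i _; apply: aP miss dense.
by rewrite -ltnS.
Qed.

(** * The approximate partition *)

Lemma greedy_cliques (U : finType) (G : sgraph U) (I : eqType) (s : seq I)
    (A : I -> {set U}) (D : I -> nat) (S : {set U}) (m : nat) :
  uniq s -> (forall i, i \in s -> A i \subset S) ->
  (forall i j u, i \in s -> j \in s -> i != j -> u \in A i ->
     #|A j :\: nbhd G u| <= D i) ->
  (forall j, j \in s ->
     m + (if ohead s == Some j then 0 else \sum_(i <- s | i != j) D i) <= #|A j|) ->
  m ^ size s <= (size s)`! * #|cliques G (size s) S|.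
Proof.
elim: s A S => [|i s IH] A S /=; first by rewrite cliques0.
move=> /andP[is_ us] AS AD Am.
have Ai : m <= #|A i| by have := Am i (mem_head _ _); rewrite eqxx addn0.
rewrite expnS factS mulnAC -sum_cliques_link mulnC big_distrl /=.
apply: leq_trans (_ : \sum_(u in A i) m ^ size s <= _).
  by rewrite sum_nat_const mulnC leq_mul2r Ai orbT.
rewrite [leqRHS](big_setID (A i)) /= (setIidPr (AS i (mem_head _ _))).
apply: leq_trans (leq_addr _ _); apply: leq_sum => u uA; rewrite mulnC.
apply: (IH (fun j => A j :&: nbhd G u)) => // [j js|i' j v is' js ij|j js].
- by rewrite setSI // AS // inE js orbT.
- rewrite in_setI => /andP[vA _].
  apply: leq_trans (AD i' j v _ _ ij vA); rewrite ?inE ?is' ?js ?orbT //.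
  by apply: subset_leq_card; rewrite setSD // subsetIl.
have ij : i != j by apply: contraNneq is_ => ->.
have := Am j; rewrite inE js orbT => /(_ isT).
rewrite (inj_eq Some_inj) (negbTE ij) big_cons ij.
have := AD i j u (mem_head _ _); rewrite inE js orbT => /(_ isT ij uA).
rewrite -(cardsID (nbhd G u) (A j)); case: ifP; lia.
Qed.

Section Partition.
Variables (U : finType) (G : sgraph U).
Implicit Types (S P Q Z : {set U}) (x y z u v : U).
Notation N := (nbhd G).
Notation n := #|U|.

Lemma many_cliques k M : (forall u, #|~: N u| <= M) -> (3 * k + 2) * M <= 3 * n ->
  n ^ k.+1 <= (3 * k + 2) ^ k.+1 * k.+1`! * #|cliques G k.+1 setT|.
Proof.
move=> miss dense.
have kM : k * M <= n by nia.
have := @greedy_cliques U G 'I_k.+1 (enum 'I_k.+1) (fun=> setT) (fun=> M) setT (n - k * M).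
rewrite -cardE card_ord => H.
have {}H : (n - k * M) ^ k.+1 <= k.+1`! * #|cliques G k.+1 setT|.
  apply: H => [|//|i j u _ _ _ _|j _]; first exact: enum_uniq.
    by rewrite setTD miss.
  rewrite cardsT; case: ifP => _; first lia.
  rewrite big_enum_cond /= sum_nat_const.
  have -> : #|(fun i : 'I_k.+1 => i != j)| = k.
    by apply: etrans (_ : #|predC1 j| = _); [exact: eq_card | rewrite cardC1 card_ord].
  by rewrite subnK.
rewrite -mulnA; apply: leq_trans (leq_mul (leqnn _) H); rewrite -expnMn.
apply: leq_expl; rewrite mulnBr; nia.
Qed.

Definition conflicting k c z : {set U * U} :=
  [set p | [&& adj G p.1 p.2, alike G k c p.1 z & alike G k c p.2 z]].

Lemma card_conflicting k c :
  n ^ (2 * k) * \sum_z #|conflicting k c z| <= c ^ 2 * #|conf G k setT|.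
Proof.
pose t (q : U * (U * U)) : {set {set U} * {set U}} :=
  setX (cliques G k (N q.2.1 :&: N q.1)) (cliques G k (N q.2.2 :&: N q.1)).
pose Y := [set q : U * (U * U) | (q.1 \in [set: U]) && (q.2 \in conflicting k c q.1)].
have YE : \sum_z #|conflicting k c z| = #|Y|.
  by rewrite (card_pairs setT (conflicting k c)); apply: eq_bigl => z; rewrite in_setT.
apply: leq_trans (_ : c ^ 2 * \sum_(q in Y) #|t q| <= _).
  rewrite YE mulnC -sum_nat_const big_distrr /=; apply: leq_sum => -[z [x y]].
  rewrite [X in is_true X -> _]in_set /= => /andP[_]; rewrite in_set => /and3P[/= _ xz yz].
  rewrite /t cardsX /= mulnACA mul2n -addnn expnD; apply: leq_mul; exact: ltnW.
rewrite leq_mul2l -card_pairs; apply/orP; right.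
apply: (@leq_card_map _ _ _ _ (fun p => ((p.1.2.1, p.1.2.2, p.1.1), p.2))).
  by move=> [[z [x y]] [P Q]] [[z' [x' y']] [P' Q']] _ _ /= [-> -> -> -> ->].
move=> [[z [x y]] [P Q]]; rewrite [X in is_true X -> _]in_set /= => /andP[].
rewrite [X in is_true X -> _]in_set /= => /andP[_]; rewrite in_set => /and3P[/= xy _ _].
rewrite in_setX /= => /andP[PK QK].
by rewrite in_conf !in_setT xy !setTI PK QK.
Qed.

Lemma partition_of_clique k c b Z : 0 < b -> Z \in cliques G k.+1 setT ->
  b * b.+1 * (#|[set x | (Z, x) \in isolated G k c]| * n +
    \sum_(z in Z) #|conflicting k c z|) <= n ^ 2 ->
  exists T : 'I_k.+1 -> {set U},
    [/\ forall i j, i != j -> [disjoint T i & T j],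
        #|~: \bigcup_i T i| <= n %/ b &
        forall i v, v \in T i -> #|N v :&: T i| <= n %/ b].
Proof.
move=> b0 ZK; set f := #|[set x | _]|; set g := \sum_(z in Z) _; set h := n %/ b => small.
have [/subsetP ZT Zk _] := cliquesP _ _ _ _ ZK.
pose X := ~: [set x | (Z, x) \in isolated G k c].
pose p x := odflt x [pick z in Z | alike G k c x z].
have pP x : x \in X -> p x \in Z /\ alike G k c x (p x).
  rewrite in_setC in_set in_isolated ZK /= negb_forall_in.
  case/exists_inP=> z; rewrite in_setD negbK => /andP[_ zZ] xz.
  by rewrite /p; case: pickP => [z' /andP[]|/(_ z)] //=; rewrite zZ xz.
pose inner x := [set y in X | adj G x y && (p y == p x)].
pose Bd := [set x in X | h < #|inner x|].
have Bdg : #|Bd| * h.+1 <= g.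
  apply: leq_trans (_ : \sum_(x in Bd) #|inner x| <= _).
    by rewrite -sum_nat_const; apply: leq_sum => x /setIdP[].
  rewrite /g -!card_pairs.
  apply: (@leq_card_map _ _ _ _ (fun q => (p q.1, q))) => [q q' _ _ [_ ->] //|[x y]].
  rewrite [X in is_true X -> _]in_set /= => /andP[/setIdP[xX _]].
  case/setIdP=> yX /andP[xy /eqP pxy].
  have [pxZ xpx] := pP x xX; have [_ ypy] := pP y yX.
  by rewrite [X in is_true X]in_set /= pxZ in_set /= xy xpx -pxy ypy.
have bh : n < b * h.+1 by rewrite mulnC /h ltn_ceil.
have fBd : f + #|Bd| <= h.
  case: (posnP n) => [n0|n0].
    have noU (S : {set U}) : #|S| = 0 by have := max_card S; rewrite n0 leqn0 => /eqP.
    by rewrite /f !noU.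
  rewrite /h leq_divRL // -(leq_pmul2r n0) -(leq_pmul2r (ltn0Sn b)).
  have : #|Bd| * n <= b * g.
    by apply: leq_trans (leq_mul (leqnn _) (ltnW bh)) _; rewrite mulnCA leq_mul2l Bdg orbT.
  move: small; rewrite -mulnn; nia.
have /card_gt0P[z0 _] : 0 < #|Z| by rewrite Zk.
pose zi (i : 'I_k.+1) := nth z0 (enum Z) i.
have zi_inj i j : zi i = zi j -> i = j.
  move=> eij; apply: val_inj; apply/eqP.
  have sz (l : 'I_k.+1) : (l < size (enum Z)) by rewrite -cardE Zk.
  by rewrite -(nth_uniq z0 (sz i) (sz j) (enum_uniq _)); apply/eqP.
have ziP z : z \in Z -> exists i, zi i = z.
  move=> zZ; have lt : index z (enum Z) < k.+1 by rewrite -Zk cardE index_mem mem_enum.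
  by exists (Ordinal lt); rewrite /zi /= nth_index // mem_enum.
pose T i := [set x in X :\: Bd | p x == zi i].
exists T; split.
- move=> i j; apply: contraNT => /pred0Pn[x /andP[/setIdP[_ /eqP xi] /setIdP[_ /eqP xj]]].
  by apply/eqP/zi_inj; rewrite -xi.
- apply: leq_trans fBd.
  have sub : (~: \bigcup_i T i) \subset [set x | (Z, x) \in isolated G k c] :|: Bd.
    apply/subsetP => x; rewrite in_setC in_setU; apply: contraR; rewrite negb_or => /andP[xf xB].
    have xX : x \in X by rewrite in_setC.
    have [pxZ _] := pP x xX; have [i zix] := ziP _ pxZ.
    by apply/bigcupP; exists i => //; rewrite in_set in_setD xB xX zix /=.
  exact: leq_trans (subset_leq_card sub) (leq_card_setU _ _).
move=> i v /setIdP[/setDP[vX]]; rewrite in_set vX -leqNgt => vh /eqP vi.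
apply: leq_trans vh; apply: subset_leq_card; apply/subsetP => y.
rewrite in_setI in_nbhd => /andP[vy /setIdP[/setDP[yX _] /eqP yi]].
by rewrite in_set yX vy yi vi /=.
Qed.

End Partition.

Lemma rough_partition k b q : 0 < b -> exists t : nat,
  forall (U : finType) (G : sgraph U) M e,
  0 < #|U| -> (forall u, #|~: nbhd G u| <= M) ->
  (3 * k + 2) * M + e <= 3 * #|U| -> #|U| <= q * e ->
  t * #|cliques G k.+2 setT| <= #|U| ^ k.+2 ->
  exists T : 'I_k.+1 -> {set U},
    [/\ forall i j, i != j -> [disjoint T i & T j],
        #|~: \bigcup_i T i| <= #|U| %/ b &
        forall i v, v \in T i -> #|nbhd G v :&: T i| <= #|U| %/ b].
Proof.
move=> b0; have [A AP] := card_isolated k; have [C CP] := card_conf k.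
pose ka := (3 * k + 2) ^ k.+1 * k.+1`!; pose B := b * b.+1.
pose c := (4 * A * ka * B).+1; pose C' := q ^ k * C.
exists (2 * ka * B * (c ^ 2 * C') + c) => U G M e n0 miss dense ne few.
set n := #|U| in n0 dense ne few *; set K := #|cliques G k.+2 setT| in few.
have dense' : (3 * k + 2) * M <= 3 * n by lia.
have {AP} hA := AP U G M c miss dense'; rewrite -/n -/K in hA.
have {CP} hC := CP U G setT M e miss; rewrite cardsT -/n -/K in hC; have {}hC := hC dense.
have hK := many_cliques miss dense'; rewrite -/ka -/n in hK.
have hT := card_conflicting G k c; rewrite -/n in hT.
pose f Z := #|[set x | (Z, x) \in isolated G k c]|.
pose g (Z : {set U}) := \sum_(z in Z) #|conflicting G k c z|.
have sumf : \sum_(Z in cliques G k.+1 setT) f Z = #|isolated G k c|.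
  rewrite -card_pairs; apply: eq_card => -[Z x].
  by rewrite [LHS]in_set /= in_set !in_isolated andbA andbb.
have sumg : \sum_(Z in cliques G k.+1 setT) g Z <=
    n ^ k * \sum_z #|conflicting G k c z|.
  rewrite /g (exchange_big_dep predT) //= big_distrr /=; apply: leq_sum => z _.
  rewrite sum_nat_const leq_mul2r; apply/orP; right.
  apply: leq_trans (card_cliques G k (setT :&: nbhd G z)).
  apply: leq_trans (_ : #|[set Z in cliques G k.+1 setT | z \in Z]| <= _).
    by apply: subset_leq_card; apply/subsetP => Z ZK; rewrite in_set.
  apply: (@leq_card_map _ _ _ _ (fun Z : {set U} => Z :\ z)).
    by move=> Z Z' /setIdP[_ zZ] /setIdP[_ zZ'] eZ; rewrite -(setD1K zZ) eZ setD1K.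
  by move=> Z /setIdP[ZK zZ]; apply: cliquesD1.
have ka0 : 0 < ka by rewrite muln_gt0 fact_gt0 expn_gt0 addn2.
have Kr0 : 0 < #|cliques G k.+1 setT|.
  rewrite lt0n; apply/eqP => Z0; move: hK; rewrite Z0 muln0 leqn0.
  by rewrite expn_eq0 andbT; lia.
suff hsum : \sum_(Z in cliques G k.+1 setT) B * (f Z * n + g Z) <=
    n ^ 2 * #|cliques G k.+1 setT|.
  have [Z ZK small] := exists_sum_le Kr0 hsum.
  exact: partition_of_clique b0 ZK small.
rewrite -big_distrr /= big_split /= -big_distrl /= sumf.
apply: leq_trans (_ : B * (#|isolated G k c| * n +
    n ^ k * \sum_z #|conflicting G k c z|) <= _).
  by rewrite leq_mul2l leq_add2l sumg orbT.
have nek : n ^ k <= q ^ k * e ^ k by rewrite -expnMn leq_expl.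
have nk0 : 0 < n ^ k by rewrite expn_gt0 n0.
move: hA hC hK hT few nek nk0; rewrite mul2n -addnn !expnS expn0 muln1 !expnD.
rewrite /C'; move: (n ^ k) (q ^ k) (e ^ k) => nk qk ek.
move: #|isolated G k c| #|conf G k setT| (\sum_z _) #|cliques G k.+1 setT| => F cf t3 Kr.
move=> hA hC hK hT few nek nk0.
have h1 : cf <= qk * C * (n * nk) * K.
  rewrite -(leq_pmul2l nk0); apply: leq_trans (leq_mul nek (leqnn cf)) _.
  rewrite -mulnA; apply: leq_trans (leq_mul (leqnn qk) hC) _.
  by apply: eq_leq; lia.
have h2 : nk * t3 <= c * c * (qk * C) * n * K.
  rewrite -(leq_pmul2l nk0) mulnA; apply: leq_trans hT _.
  apply: leq_trans (leq_mul (leqnn _) h1) _.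
  by apply: eq_leq; lia.
have h3 : 2 * ka * B * F <= n * (n * nk).
  have cK : c * K <= n * (n * nk) by apply: leq_trans few; rewrite mulnDl leq_addl.
  rewrite -(@leq_pmul2l c) // mulnCA.
  apply: leq_trans (leq_mul (leqnn _) hA) _.
  apply: leq_trans (_ : 2 * ka * B * (A * (2 * (n * (n * nk)))) <= _).
    by rewrite !leq_mul2l; apply/orP; right; apply/orP; right; lia.
  apply: leq_trans (_ : (4 * A * ka * B) * (n * (n * nk)) <= _).
    by apply: eq_leq; lia.
  by rewrite leq_mul2r leqnSn orbT.
have h4 : 2 * ka * B * (nk * t3) <= n * (n * (n * nk)).
  apply: leq_trans (leq_mul (leqnn _) h2) _.
  apply: leq_trans (_ : n * (2 * ka * B * (c * c * (qk * C)) * K) <= _).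
    by apply: eq_leq; lia.
  rewrite leq_mul2l; apply/orP; right; apply: leq_trans few.
  by rewrite mulnDl leq_addr.
rewrite -(leq_pmul2l ka0).
apply: leq_trans (_ : n * n * (n * nk) <= _); last first.
  by apply: leq_trans (leq_mul (leqnn (n * n)) hK) _; apply: eq_leq; lia.
rewrite -(@leq_pmul2l 2) //.
have := leq_mul h3 (leqnn n); lia.
Qed.

(** * Cliques around a given partition *)

Lemma room_one k M n m h a c T d : (3 * k + 2) * M <= 3 * n ->
  12 * m <= M -> 2 * k.+2 * h <= m -> a + c = T -> T <= M + h -> 2 * c <= M ->
  M + h - T + d + n <= k.+1 * (M + h) + h -> m + d <= a.
Proof.
rewrite [(3 * k + 2) * M]mulnDl -(mulnA 3) -(mulnA 2) !mulSn !mulnDr.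
by move: (k * M) (k * h) => kM kh; lia.
Qed.

Lemma room_two k M n m h v w a c c' Ti Ti' T T' d : (3 * k + 2) * M <= 3 * n ->
  12 * m <= M -> 2 * k.+2 * h <= m -> v <= m -> w <= m ->
  v + Ti = T -> w + Ti' = T -> Ti + c <= M -> Ti' + c' <= M ->
  T' <= a + c + c' -> T <= M + h -> T' <= M + h ->
  M + h - T' + (M + h - T + d) + n <= k.+1 * (M + h) + h -> m + d <= a.
Proof.
rewrite [(3 * k + 2) * M]mulnDl -(mulnA 3) -(mulnA 2) !mulSn !mulnDr.
by move: (k * M) (k * h) => kM kh; lia.
Qed.

Section Parts.
Variables (U : finType) (G : sgraph U) (k M h m : nat) (T : 'I_k.+1 -> {set U}).
Notation N := (nbhd G).
Hypothesis miss : forall u, #|~: N u| <= M.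
Hypothesis dense : (3 * k + 2) * M <= 3 * #|U|.
Hypothesis disj : forall i j, i != j -> [disjoint T i & T j].
Hypothesis cover : #|~: \bigcup_i T i| <= h.
Hypothesis inner : forall i v, v \in T i -> #|N v :&: T i| <= h.
Hypothesis mM : 12 * m <= M.
Hypothesis hm : 2 * k.+2 * h <= m.

Let D i := M + h - #|T i|.

Lemma miss_parts i j v : i != j -> #|T i :\: N v| + #|T j :\: N v| <= M.
Proof.
move=> ij; apply: leq_trans (miss v).
have /eqP <- : #|(T i :\: N v) :|: (T j :\: N v)| == #|T i :\: N v| + #|T j :\: N v|.
  rewrite (leq_card_setU (T i :\: N v) (T j :\: N v)).
  apply: disjointWl (subsetDl _ _) _; apply: disjointWr (subsetDl _ _) _; exact: disj.
by apply: subset_leq_card; rewrite -setDUl setDE subsetIr.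
Qed.

Lemma card_part_le i : #|T i| <= M + h.
Proof.
have [->|[v vT]] := set_0Vmem (T i); first by rewrite cards0.
rewrite -(cardsID (N v) (T i)) addnC; apply: leq_add; last by rewrite setIC inner.
by apply: leq_trans (miss v); apply: subset_leq_card; rewrite setDE subsetIr.
Qed.

Lemma miss_other_part i j v : i != j -> v \in T i -> #|T j :\: N v| <= D i.
Proof.
move=> ij vT; have := miss_parts v ij; have := inner vT.
by have := cardsID (N v) (T i); rewrite [T i :&: _]setIC /D; lia.
Qed.

Lemma sum_deficit : \sum_i D i + #|U| <= k.+1 * (M + h) + h.
Proof.
have -> : k.+1 * (M + h) = \sum_i D i + \sum_i #|T i|.
  rewrite -big_split /= (eq_bigr (fun=> M + h)) ?sum_nat_const ?card_ord // => i _.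
  by rewrite subnK ?card_part_le.
rewrite -addnA leq_add2l -(cardsC (\bigcup_i T i)); apply: leq_add => //.
elim/big_rec2: _ => [|i s S _ IH]; first by rewrite cards0.
by apply: leq_trans (leq_card_setU _ _) _; rewrite leq_add2l.
Qed.

Lemma cliques_in_nbhd v : (forall i, m <= #|N v :&: T i|) ->
  m ^ k.+1 <= k.+1`! * #|cliques G k.+1 (N v)|.
Proof.
move=> vm.
(* At most one part contains more than M/2 non-neighbours of v; the greedy choice
   starts there. *)
pose i0 := odflt ord0 [pick i | M < 2 * #|T i :\: N v|].
have few j : j != i0 -> 2 * #|T j :\: N v| <= M.
  rewrite /i0; case: pickP => [i|/(_ j)]; last by rewrite ltnNge => /negbFE.
  by move=> /= iM ji; have := miss_parts v ji; lia.
have sE : perm_eq (enum 'I_k.+1) (i0 :: rem i0 (enum 'I_k.+1)).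
  by apply: perm_to_rem; rewrite mem_enum.
set s := i0 :: _ in sE.
have ss : size s = k.+1 by rewrite -(perm_size sE) -cardE card_ord.
have := @greedy_cliques U G _ s (fun i => N v :&: T i) D (N v) m.
rewrite ss; apply => [|i _|i j u _ _ ij|j _].
- by rewrite -(perm_uniq sE) enum_uniq.
- exact: subsetIl.
- rewrite in_setI => /andP[_ uT]; apply: leq_trans (miss_other_part ij uT).
  by apply: subset_leq_card; rewrite setSD ?subsetIr.
rewrite (inj_eq Some_inj); case: eqP => [_|/eqP]; rewrite ?addn0 // eq_sym => ji0.
rewrite -(perm_big _ sE) big_enum_cond /=.
have := sum_deficit; rewrite (bigD1 j) //=; have := few j ji0.
move: (\sum_(i | i != j) D i) => sD; have := card_part_le j.
have := cardsID (N v) (T j); rewrite [T j :&: _]setIC /D.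
move=> *; apply: (@room_one k M #|U| m h _ #|T j :\: N v|); eassumption.
Qed.

Lemma cliques_in_common_nbhd i v w :
  #|N v :&: T i| <= m -> #|N w :&: T i| <= m ->
  m ^ k <= k`! * #|cliques G k (N v :&: N w)|.
Proof.
move=> vm wm.
have sE : perm_eq (enum 'I_k.+1) (i :: rem i (enum 'I_k.+1)).
  by apply: perm_to_rem; rewrite mem_enum.
set s := rem _ _ in sE.
have us : uniq (i :: s) by rewrite -(perm_uniq sE) enum_uniq.
have ss : size s = k by have := perm_size sE; rewrite -cardE card_ord => -[].
have := @greedy_cliques U G _ s (fun j => (N v :&: N w) :&: T j) D (N v :&: N w) m.
rewrite ss; apply => [|j _|j l u _ _ jl|j js].
- by case/andP: us.
- exact: subsetIl.
- rewrite in_setI => /andP[_ uT]; apply: leq_trans (miss_other_part jl uT).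
  by apply: subset_leq_card; rewrite setSD ?subsetIr.
have ij : i != j by case/andP: us => + _; apply: contraNneq => ->.
apply: leq_trans (_ : m + \sum_(l <- s | l != j) D l <= _).
  by rewrite leq_add2l; case: ifP.
have := sum_deficit; rewrite (bigD1 j) //=.
have -> : \sum_(l | l != j) D l = \sum_(l <- i :: s | l != j) D l.
  by rewrite -(perm_big _ sE) big_enum_cond.
rewrite big_cons ij.
move: (\sum_(l <- s | l != j) D l) => sD; have := card_part_le j; have := card_part_le i.
have : #|T j| <= #|(N v :&: N w) :&: T j| + #|T j :\: N v| + #|T j :\: N w|.
  rewrite -(cardsID (N v :&: N w) (T j)) [T j :&: _]setIC -addnA leq_add2l setDIr.
  exact: leq_card_setU.
have := miss_parts v ij; have := miss_parts w ij.
have := cardsID (N v) (T i); rewrite [T i :&: _]setIC.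
have := cardsID (N w) (T i); rewrite [T i :&: _]setIC /D.
move=> *; apply: (@room_two k M #|U| m h #|N v :&: T i| #|N w :&: T i|); eassumption.
Qed.

End Parts.

(** * Embedding H *)

Lemma containsP (V U : finType) (H : sgraph V) (G : sgraph U) :
  reflect (exists f : V -> U, injective f /\ forall x y, adj H x y -> adj G (f x) (f y))
    (contains H G).
Proof.
apply: (iffP existsP) => [[f /andP[/injectiveP fi /forallP fa]]|[f [fi fa]]].
  by exists f; split=> // x y xy; have /forallP/(_ y)/implyP := fa x; apply.
exists (finfun f); apply/andP; split.
  by apply/injectiveP => x y; rewrite !ffunE; apply: fi.
by apply/forallP => x; apply/forallP => y; apply/implyP => xy; rewrite !ffunE fa.
Qed.

Lemma proper_colouringP (V : finType) (H : sgraph V) k (c : {ffun V -> 'I_k}) :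
  reflect (forall x y, adj H x y -> c x != c y) (proper_colouring H c).
Proof.
apply: (iffP forallP) => [cH x y xy|cH x].
  by have /forallP/(_ y)/implyP := cH x; apply.
by apply/forallP => y; apply/implyP; apply: cH.
Qed.

Lemma injective_into (V U : finType) (Y : {set U}) : #|V| <= #|Y| ->
  exists g : V -> U, injective g /\ forall x, g x \in Y.
Proof.
move=> VY; exists (fun x => enum_val (widen_ord VY (enum_rank x))); split.
  by move=> x y /enum_val_inj /(congr1 val) /= /val_inj /enum_rank_inj.
by move=> x; apply: enum_valP.
Qed.

Lemma adj_neq (U : finType) (G : sgraph U) x y : adj G x y -> x != y.
Proof. by apply: contraTneq => ->; rewrite adj_irrefl. Qed.

Lemma blowup_contains (V U : finType) (H : sgraph V) (G : sgraph U) k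
    (c : {ffun V -> 'I_k}) (Q : 'I_k -> V -> U) :
  proper_colouring H c -> blowup G Q -> contains H G.
Proof.
move=> /proper_colouringP cH [Qi Qa]; apply/containsP; exists (fun x => Q (c x) x).
split=> [x y|x y /cH]; last exact: Qa.
case: (altP (c x =P c y)) => [->|cxy]; first exact: Qi.
by move=> E; have := adj_neq (Qa _ _ x y cxy); rewrite E eqxx.
Qed.

Lemma chi_colouring (V : finType) (H : sgraph V) k : chi H = k ->
  exists c : {ffun V -> 'I_k}, proper_colouring H c.
Proof. by move=> <-; rewrite /chi; case: ex_minnP => k' /existsP. Qed.

Section Subgraph.
Variables (U : finType) (G : sgraph U) (X : {set {set U}}).

Lemma subgraph_card2 : [forall e in edges G :&: X, #|e| == 2].
Proof.
apply/forall_inP => e; rewrite inE => /andP[eG _].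
exact: (forall_inP (edges_card2 G)).
Qed.

Definition subgraph := SGraph subgraph_card2.

Lemma adj_subgraph x y : adj subgraph x y = adj G x y && ([set x; y] \in X).
Proof. by rewrite /adj /= inE. Qed.
End Subgraph.

Lemma leq_ex_fam n (I : finType) (V : I -> finType) (F : forall i, sgraph (V i))
    (U : finType) (G : sgraph U) : #|U| = n ->
  (forall i, ~~ contains (F i) G) -> #|edges G| <= ex_fam n F.
Proof.
move=> Un free; pose f (x : U) : 'I_n := cast_ord Un (enum_rank x).
have fi : injective f by move=> x y /cast_ord_inj /enum_rank_inj.
have card2 : [forall e in [set f @: (e : {set U}) | e in edges G], #|e| == 2].
  apply/forall_inP => _ /imsetP[e eG ->]; rewrite card_imset //.
  exact: (forall_inP (edges_card2 G)).
pose G' := SGraph card2.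
have -> : #|edges G| = #|edges G'| by rewrite /= card_imset //; apply: imset_inj.
apply: (leq_bigmax_cond (F := fun G : sgraph 'I_n => #|edges G|)).
apply/forallP => i; apply: contra (free i) => /containsP[g [gi ga]].
pose f' (j : 'I_n) : U := enum_val (cast_ord (esym Un) j).
have f'K : cancel f' f by move=> j; rewrite /f /f' enum_valK cast_ordKV.
apply/containsP; exists (fun x => f' (g x)); split.
  by move=> x y /(can_inj f'K) /gi.
move=> x y /ga; rewrite /adj /= => /imsetP[e eG].
rewrite -[g x]f'K -[g y]f'K -imset_set1 -[X in _ :|: X]imset_set1 -imsetU.
by move=> /(imset_inj fi) E; rewrite !f'K E.
Qed.

Section TwoClasses.
Variables (V : finType) (H : sgraph V) (k : nat).
Hypothesis chiH : chi H = k.+2.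

Lemma adj_induced (S : {set V}) (x y : {x | x \in S}) :
  adj (induced H S) x y = adj H (val x) (val y).
Proof. by rewrite /adj inE imsetU !imset_set1. Qed.

Lemma leq_biex (U : finType) (G : sgraph U) : 
  (forall c : {ffun V -> 'I_k.+2}, proper_colouring H c ->
     ~~ contains (induced H (two_classes c)) G) ->
  #|edges G| <= biex #|U| H.
Proof.
move=> free; apply: leq_ex_fam => // -[c cH] /=.
by move: c cH free; rewrite chiH => c cH; apply.
Qed.

Lemma biex_witness n : biex n H < n.-1 -> exists2 c : {ffun V -> 'I_k.+2},
  proper_colouring H c & exists z : V, forall x y,
    adj H x y -> (c x < 2) -> (c y < 2) -> (x == z) || (y == z).
Proof.
case: n => // n ltn.
have card2 : [forall e in [set [set ord0; lift ord0 i] | i : 'I_n], #|e| == 2].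
  by apply/forall_inP => _ /imsetP[i _ ->]; rewrite cards2 neq_lift.
pose star := SGraph card2.
have starP x y : adj star x y -> (x == ord0) || (y == ord0).
  rewrite /adj /= => /imsetP[i _ /setP E]; have := E ord0; rewrite !inE eqxx.
  by rewrite ![ord0 == _]eq_sym.
case: (boolP [exists c : {ffun V -> 'I_k.+2}, proper_colouring H c &&
    contains (induced H (two_classes c)) star]) => [/existsP[c /andP[cH]]|].
  move=> /containsP[f [fi fa]]; exists c => //.
  have in2 x : c x < 2 -> x \in two_classes c by rewrite inE.
  case: (pickP (fun x => f x == ord0)) => [z /eqP fz|no].
    exists (val z) => x y xy cx cy.
    have := fa (exist _ x (in2 x cx)) (exist _ y (in2 y cy)).
    rewrite adj_induced => /(_ xy) /starP.
    by rewrite -fz !(inj_eq fi) -!val_eqE.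
  have [z _|V0] := pickP (predT : pred V); last first.
    have : colourable H 0.
      apply/existsP; exists [ffun x => False_rect 'I_0 (notF (esym (V0 x)))].
      by apply/forallP => x; have := V0 x.
    by move: chiH; rewrite /chi; case: ex_minnP => m _ min mE /min; rewrite mE.
  exists z => x y xy cx cy.
  have := fa (exist _ x (in2 x cx)) (exist _ y (in2 y cy)).
  by rewrite adj_induced => /(_ xy) /starP; rewrite !no.
rewrite negb_exists => /forallP free; suff: n <= biex n.+1 H by rewrite leqNgt ltn.
have cardE : #|edges star| = n.
  rewrite /= card_imset ?card_ord // => i j /setP E; have := E (lift ord0 i).
  rewrite !inE eqxx orbT (inj_eq lift_inj) [lift _ _ == _]eq_sym.
  by rewrite (negbTE (neq_lift _ _)) /= => /esym/eqP.
have := @leq_biex _ star; rewrite cardE card_ord; apply => c cH.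
by have := free c; rewrite cH.
Qed.

Lemma contains_of_cone (U : finType) (G : sgraph U) (c : {ffun V -> 'I_k.+2}) z v
    (Q : 'I_k.+1 -> V -> U) :
  proper_colouring H c ->
  (forall x y, adj H x y -> (c x < 2) -> (c y < 2) -> (x == z) || (y == z)) ->
  blowup G Q -> (forall i w, adj G v (Q i w)) -> contains H G.
Proof.
move=> /proper_colouringP cH zP [Qi Qa] vQ; apply/containsP.
(* Merging the first two colours gives a proper colouring of H - z. *)
pose c' x : 'I_k.+1 := inord (c x).-1.
have c'E x : c' x = (c x).-1 :> nat by rewrite inordK //; have := ltn_ord (c x); lia.
exists (fun x => if x == z then v else Q (c' x) x).
split=> x y.
  case: eqP => [->|_]; case: eqP => [->|_] // E.
  - by have := vQ (c' y) y; rewrite E adj_irrefl.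
  - by have := vQ (c' x) x; rewrite -E adj_irrefl.
  case: (altP (c' x =P c' y)) => [e|ne]; first by move: E; rewrite e => /Qi.
  by have := Qa _ _ x y ne; rewrite E adj_irrefl.
move=> xy; have [xz|xz] := eqVneq x z; have [yz|yz] := eqVneq y z.
- by move: xy; rewrite xz yz adj_irrefl.
- exact: vQ.
- by rewrite adj_sym; apply: vQ.
apply: Qa; apply: contraTneq (cH x y xy) => /(congr1 val) /=; rewrite !c'E negbK => E.
apply/eqP/val_inj => /=; case: (ltnP (c x) 2) => cx; last lia.
case: (ltnP (c y) 2) => cy; last lia.
by have := zP x y xy cx cy; rewrite (negbTE xz) (negbTE yz).
Qed.

(* Isolated vertices of H[S] may be embedded outside the common neighbourhood of
   Q, so they are moved to fresh vertices of that neighbourhood. *)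
Lemma leq_biex_joined (U : finType) (G : sgraph U) (X : {set {set U}})
    (Q : 'I_k -> V -> U) :
  ~~ contains H G -> X \subset edges G -> blowup G Q ->
  2 * #|V| <= #|[set u | [forall i, forall w, adj G u (Q i w)]]| ->
  (forall e u, e \in X -> u \in e -> forall i w, adj G u (Q i w)) ->
  #|X| <= biex #|U| H.
Proof.
move=> free XG [Qi Qa]; set Y := [set u | _] => YV XQ.
have YP u : reflect (forall i w, adj G u (Q i w)) (u \in Y).
  rewrite inE; apply: (iffP forallP) => [h i w|h i]; first by have /forallP/(_ w) := h i.
  by apply/forallP => w; apply: h.
have -> : #|X| = #|edges (subgraph G X)| by rewrite /= (setIidPr XG).
apply: leq_biex => c /proper_colouringP cH; apply: contra free.
move=> /containsP[f [fi fa]]; apply/containsP.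
have [|g [gi gY]] := @injective_into V U (Y :\: [set f x | x in setT]).
  set F := [set f x | x in setT].
  have : #|F| <= #|V|.
    by apply: leq_trans (leq_imset_card _ _) _; rewrite cardsT card_sig max_card.
  by have := cardsID F Y; have := subset_leq_card (subsetIl Y F);
    have := subset_leq_card (subsetIr Y F); lia.
pose F x : U := if insub x is Some s then (if f s \in Y then f s else g x)
  else if insub (c x - 2) is Some i then Q i x else g x.
have FE x : (exists s, val s = x /\ F x = if f s \in Y then f s else g x) \/
    (exists i : 'I_k, [/\ i = c x - 2 :> nat, 2 <= c x & F x = Q i x]).
  rewrite /F; case: insubP => [s _ <-|]; first by left; exists s.
  rewrite inE -leqNgt => cx; right.
  have lt : c x - 2 < k by have := ltn_ord (c x); lia.
  by exists (Ordinal lt); rewrite insubT; split.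
have gYx x : g x \in Y by have := gY x; rewrite inE => /andP[].
have gf x s : g x != f s.
  by have := gY x; rewrite inE => /andP[/negP h _]; apply/eqP => E; apply: h; rewrite E imset_f.
have FY x s : F x = (if f s \in Y then f s else g x) -> F x \in Y.
  by move=> ->; case: ifP.
exists F; split=> x y.
  have [[s [sx Fx]]|[i [ix cx Fx]]] := FE x; have [[s' [sy Fy]]|[j [jy cy Fy]]] := FE y.
  - rewrite Fx Fy; case: ifP => _; case: ifP => _ E.
    + by rewrite -sx -sy (fi _ _ E).
    + by have := gf y s; rewrite E eqxx.
    + by have := gf x s'; rewrite E eqxx.
    + exact: gi.
  - by have /YP/(_ j y) := FY _ _ Fx; rewrite -Fy => /adj_neq/eqP.
  - by have /YP/(_ i x) := FY _ _ Fy; rewrite -Fx => /adj_neq/eqP h E; case: h.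
  rewrite Fx Fy; have [<-|ij] := eqVneq i j; first exact: Qi.
  by have /adj_neq/eqP := Qa _ _ x y ij.
move=> xy.
have [[s [sx Fx]]|[i [ix cx Fx]]] := FE x; have [[s' [sy Fy]]|[j [jy cy Fy]]] := FE y.
- have := fa s s'; rewrite adj_induced sx sy adj_subgraph => /(_ xy) /andP[fxy eX].
  rewrite Fx Fy !ifT //; apply/YP; apply: XQ eX _; [exact: set22|exact: set21].
- by rewrite Fy; apply/YP/FY/Fx.
- by rewrite adj_sym Fx; apply/YP/FY/Fy.
rewrite Fx Fy; apply: Qa; apply: contraTneq (cH x y xy) => ij.
by rewrite negbK; apply/eqP/val_inj => /=; move: ix jy; rewrite ij; lia.
Qed.
End TwoClasses.

(** * Deleting heavy edges and bad vertices *)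

Lemma sum_cliques_nbhd (U : finType) (G : sgraph U) k M (S : {set U}) :
  (forall u, #|~: nbhd G u| <= M) -> (3 * k + 2) * M <= 3 * #|U| ->
  #|U| * #|cliques G k S| <= (3 * k + 2) * \sum_u #|cliques G k (S :&: nbhd G u)|.
Proof.
move=> miss dense.
have ->: \sum_u #|cliques G k (S :&: nbhd G u)| =
    \sum_(P in cliques G k S) #|[set u | P \subset nbhd G u]|.
  transitivity (\sum_(u in [set: U]) #|cliques G k (S :&: nbhd G u)|).
    by apply: eq_bigl => u; rewrite in_setT.
  rewrite -!card_pairs; apply/eqP; rewrite eqn_leq; apply/andP; split;
    apply: (@leq_card_map _ _ _ _ (fun p => (p.2, p.1)));
    try by move=> [a b] [a' b'] _ _ [-> ->].
    move=> [u P]; rewrite [X in is_true X -> _]in_set [X in _ -> is_true X]in_set /=.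
    case/andP=> _ /cliquesP[]; rewrite subsetI => /andP[PS PN] Pk cP.
    by rewrite in_set PN andbT; apply/cliquesP.
  move=> [P u]; rewrite [X in is_true X -> _]in_set [X in _ -> is_true X]in_set /=.
  case/andP=> /cliquesP[PS Pk cP]; rewrite in_set in_setT => PN.
  by apply/cliquesP; rewrite subsetI PS PN.
rewrite mulnC -sum_nat_const big_distrr /=; apply: leq_sum => P /cliquesP[_ Pk _].
have : #|~: [set u | P \subset nbhd G u]| <= k * M.
  have sub : (~: [set u | P \subset nbhd G u]) \subset \bigcup_(p in P) (~: nbhd G p).
    apply/subsetP => u; rewrite !inE => /subsetPn[p pP pu]; apply/bigcupP; exists p => //.
    by rewrite in_setC -nbhdC.
  apply: leq_trans (subset_leq_card sub) _.
  apply: leq_trans (_ : \sum_(p in P) #|~: nbhd G p| <= _); last first.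
    by rewrite -Pk; apply: sum_leq_card.
  elim/big_rec2: _ => [|p s T _ IH]; first by rewrite cards0.
  by apply: leq_trans (leq_card_setU _ _) _; rewrite leq_add2l.
have := cardsC [set u | P \subset nbhd G u].
move: #|[set u | _]| #|~: [set u | _]| => y z yz zM; move: dense.
move: (#|U|) yz => n yz; nia.
Qed.

Section FreeGraphs.
Variables (V : finType) (H : sgraph V) (k : nat).
Hypothesis chiH : chi H = k.+2.

Lemma few_cliques t : exists n0, forall (U : finType) (G : sgraph U),
  n0 <= #|U| -> ~~ contains H G -> t * #|cliques G k.+2 setT| <= #|U| ^ k.+2.
Proof.
have [q' [n0 pick]] := pick_blowup V k.+2 t; exists n0 => U G Un.
apply: contraNT; rewrite -ltnNge => many.
have [c cH] := chi_colouring chiH.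
have [||Q [QG _]] := pick U G unit setT (fun=> setT) Un.
- by rewrite cardsT card_unit.
- by rewrite cardsT card_unit muln1 sum_nat_const cardsT card_unit mul1n ltnW.
exact: blowup_contains cH QG.
Qed.

Lemma bad_vertices a : exists C n0, forall (U : finType) (G : sgraph U) (B : {set U}),
  n0 <= #|U| -> ~~ contains H G ->
  (forall v, v \in B -> #|U| ^ k.+1 <= a * #|cliques G k.+1 (nbhd G v)|) ->
  #|B| * #|U| <= C * biex #|U| H.
Proof.
have [q' [n0 pick]] := pick_blowup V k.+1 a.
exists (q' * #|V| * 2), (maxn n0 2) => U G B; rewrite geq_max => /andP[Un U2] free rich.
case: (posnP #|B|) => [->|B0] //.
have [|Q [QG]] := pick U G U B (nbhd G) Un B0.
  by rewrite mulnC -sum_nat_const big_distrr /=; apply: leq_sum.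
set B' := [set v in B | _] => BB'.
have B'P v : v \in B' -> forall i w, adj G v (Q i w).
  by move=> /setIdP[_ /forallP h] i w; have /forallP/(_ w) := h i; rewrite in_nbhd.
have B'V : #|B'| <= #|V|.
  rewrite leqNgt; apply: contra free => /ltnW /injective_into[g [gi gB]].
  have [c cH] := chi_colouring chiH.
  apply: blowup_contains cH (blowup_add_part gi _ QG) => w j w'; exact: B'P.
have /card_gt0P[v vB] : 0 < #|B'| by rewrite lt0n; apply/eqP => Z; rewrite Z muln0 in BB'; lia.
have Ub : #|U| <= 2 * biex #|U| H.
  case: (leqP #|U|.-1 (biex #|U| H)) => [|/(biex_witness chiH)[c cH [z zP]]]; first lia.
  by case/negP: free; apply: contains_of_cone cH zP QG (B'P v vB).
rewrite -mulnA leq_mul //; apply: leq_trans BB' _; by rewrite leq_mul2l B'V orbT.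
Qed.

Lemma heavy_edges a : exists C n0, forall (U : finType) (G : sgraph U) M
    (X : {set {set U}}),
  n0 <= #|U| -> (forall u, #|~: nbhd G u| <= M) -> (3 * k + 2) * M <= 3 * #|U| ->
  ~~ contains H G -> X \subset edges G ->
  (forall e, e \in X ->
     #|U| ^ k <= a * #|cliques G k [set u | e \subset nbhd G u]|) ->
  #|X| <= C * biex #|U| H.
Proof.
have [q' [n0 pick]] := pick_blowup V k (a * (3 * k + 2)).
exists q', (maxn n0 (q' * (2 * #|V|)).+1) => U G M X.
rewrite geq_max => /andP[Un UV] miss dense free XG heavy.
case: (posnP #|X|) => [->|X0] //.
have U0 : 0 < #|U| by lia.
pose S (p : {set U} * U) := [set u | p.1 \subset nbhd G u] :&: nbhd G p.2.
have [||Q [QG]] := pick U G _ (setX X [set: U]) S Un.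
- by rewrite cardsX cardsT muln_gt0 X0.
- have -> : \sum_(p in setX X [set: U]) #|cliques G k (S p)| = \sum_(e in X) \sum_u
      #|cliques G k ([set u | e \subset nbhd G u] :&: nbhd G u)|.
    by rewrite pair_big_dep /=; apply: eq_bigl => -[e u]; rewrite in_setX in_setT.
  have -> : #|U| ^ k * #|setX X [set: U]| = \sum_(e in X) #|U| ^ k * #|U|.
    by rewrite sum_nat_const cardsX cardsT mulnCA.
  rewrite big_distrr /=; apply: leq_sum => e eX.
  apply: leq_trans (leq_mul (heavy e eX) (leqnn _)) _; rewrite -!mulnA leq_mul2l.
  by rewrite [_ * #|U|]mulnC (sum_cliques_nbhd _ miss dense) orbT.
set W := [set p in setX X _ | _].
pose XQ := [set e in X | [forall i, forall w, e \subset nbhd G (Q i w)]].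
pose Y := [set u | [forall i, forall w, adj G u (Q i w)]].
have WXY : #|W| <= #|XQ| * #|Y|.
  rewrite -cardsX; apply: subset_leq_card; apply/subsetP => -[e u].
  rewrite in_set in_setX => /andP[/andP[eX _] /forallP h].
  have h' i w : (e \subset nbhd G (Q i w)) && adj G u (Q i w).
    have /forallP/(_ w) := h i; rewrite /S in_setI in_set /= in_nbhd; exact.
  rewrite in_setX !in_set eX /=; apply/andP; split.
    by apply/forallP => i; apply/forallP => w; case/andP: (h' i w).
  by apply/forallP => i; apply/forallP => w; case/andP: (h' i w).
rewrite cardsX cardsT => /leq_trans /(_ (leq_mul (leqnn _) WXY)) XW.
have XQX : #|XQ| <= #|X| by apply: subset_leq_card; apply/subsetP => e /setIdP[].
have YU : #|Y| <= #|U| by exact: max_card.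
have YV : 2 * #|V| <= #|Y|.
  have : #|X| * #|U| <= #|X| * (q' * #|Y|).
    by apply: leq_trans XW _; rewrite mulnCA leq_mul2r XQX orbT.
  rewrite leq_pmul2l // => UY.
  have := leq_trans UV UY; rewrite ltn_mul2l => /andP[_]; exact: ltnW.
have XXQ : #|X| <= q' * #|XQ|.
  rewrite -(leq_pmul2r U0); apply: leq_trans XW _; rewrite mulnA leq_mul2l YU orbT //.
apply: leq_trans XXQ _; rewrite leq_mul2l; apply/orP; right.
apply: (leq_biex_joined chiH free _ QG YV) => [|e u /setIdP[_ /forallP h] ue i w].
  by apply: subset_trans XG; apply/subsetP => e /setIdP[].
by have /forallP/(_ w)/subsetP/(_ u ue) := h i; rewrite in_nbhd adj_sym.
Qed.

End FreeGraphs.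

Lemma div_double n q : 0 < q -> q <= n -> n <= 2 * q * (n %/ q).
Proof.
move=> q0 qn; have := ltn_ceil n q0; have : 0 < n %/ q by rewrite divn_gt0.
move: (n %/ q) => d d0; nia.
Qed.

Lemma partite_deletion (V : finType) (H : sgraph V) k : chi H = k.+2 ->
  exists C, forall q, 0 < q -> exists n0, forall (U : finType) (G : sgraph U),
  n0 <= #|U| ->
  (forall u, (3 * k + 2) * #|~: nbhd G u| + #|U| %/ q <= 3 * #|U|) ->
  ~~ contains H G ->
  exists D : {set {set U}}, [/\ D \subset edges G, #|D| <= C * biex #|U| H &
    partite k.+1 (del_edges G D)].
Proof.
move=> chiH; pose Nk := 3 * k + 2; pose a j := (24 * Nk) ^ j * j`!.
have [C1 [n1 heavyP]] := heavy_edges chiH (a k).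
have [C2 [n2 badP]] := bad_vertices chiH (a k.+1).
exists (C1 + C2) => q q0; pose b := 24 * Nk * k.+2.
have Nk0 : 0 < Nk by rewrite /Nk; lia.
have b0 : 0 < b by rewrite /b; lia.
have [t roughP] := @rough_partition k b (2 * q) b0.
have [n3 fewP] := few_cliques chiH t.
exists (maxn n1 (maxn n2 (maxn n3 (maxn q (12 * Nk))))) => U G.
rewrite !geq_max => /and5P[Un1 Un2 Un3 Uq UN] degG free.
set n := #|U| in Un1 Un2 Un3 Uq UN degG *.
pose e := n %/ q; pose M := (3 * n - e) %/ Nk; pose m := n %/ (12 * Nk); pose h := n %/ b.
have en : e <= n by apply: leq_div.
have n0 : 0 < n by lia.
have miss u : #|~: nbhd G u| <= M.
  by rewrite /M leq_divRL // mulnC; have := degG u; rewrite -/Nk -/e; lia.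
have dense : Nk * M + e <= 3 * n by have := leq_divM (3 * n - e) Nk; rewrite -/M; lia.
have mM : 12 * m <= M.
  rewrite leq_divRL //; have := leq_divM n (12 * Nk); rewrite -/m; lia.
have hm : 2 * k.+2 * h <= m.
  rewrite leq_divRL ?muln_gt0 //; have := leq_divM n b; rewrite -/h /b; lia.
have nm j : n ^ j <= (24 * Nk) ^ j * m ^ j.
  rewrite -expnMn leq_expl //; have := @div_double n (12 * Nk); rewrite -/m; lia.
have ne : n <= 2 * q * e by apply: div_double.
have dense' : Nk * M <= 3 * n by lia.
have [T [disj cover inner]] := roughP U G M e n0 miss dense ne (fewP U G Un3 free).
have rich j (S : {set U}) : m ^ j <= j`! * #|cliques G j S| -> n ^ j <= a j * #|cliques G j S|.
  move=> mj; apply: leq_trans (nm j) _; by rewrite /a -mulnA leq_mul2l mj orbT.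
pose B := [set v | m ^ k.+1 <= k.+1`! * #|cliques G k.+1 (nbhd G v)|].
pose X := [set f in edges G | m ^ k <= k`! * #|cliques G k [set u | f \subset nbhd G u]|].
pose DB := \bigcup_(v in B) [set [set v; y] | y : U].
exists (X :|: (edges G :&: DB)); split.
- rewrite subUset subsetIl andbT; apply/subsetP => f /setIdP[]; by [].
- apply: leq_trans (leq_card_setU _ _) _; rewrite mulnDl; apply: leq_add.
    apply: heavyP miss dense' free _ _ => //.
      by apply/subsetP => f /setIdP[].
    by move=> f /setIdP[_]; apply: rich.
  apply: leq_trans (badP U G B Un2 free _).
    apply: leq_trans (subset_leq_card (subsetIr _ _)) _.
    rewrite -sum_nat_const /DB; elim/big_rec2: _ => [|v s S _ IH]; first by rewrite cards0.
    apply: leq_trans (leq_card_setU _ _) _; apply: leq_add IH.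
    exact: leq_trans (leq_imset_card _ _) (max_card _).
  by move=> v; rewrite in_set; apply: rich.
pose c v : 'I_k.+1 := odflt ord0 [pick i | #|nbhd G v :&: T i| < m].
have cP v : v \notin B -> #|nbhd G v :&: T (c v)| <= m.
  rewrite in_set /c; case: pickP => [i im _|no]; first exact: ltnW.
  case/negP; apply: (cliques_in_nbhd miss dense' disj cover inner mM hm) => i.
  by rewrite leqNgt no.
apply/existsP; exists [ffun i => [set v | c v == i]]; apply/and3P; split.
- apply/eqP/setP => v; rewrite in_setT; apply/bigcupP; exists (c v) => //.
  by rewrite ffunE in_set.
- apply/forallP => i; apply/forallP => j; apply/implyP; apply: contraNT.
  case/pred0Pn=> v /=; rewrite !ffunE !in_set => /andP[/eqP <- /eqP <-] //.
apply/forallP => i; apply/forall_inP => v; rewrite ffunE in_set => /eqP vi.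
apply/forall_inP => w; rewrite in_set => /eqP wi.
apply/negP; rewrite /adj /= in_setD in_setU in_setI negb_or negb_and.
case/andP=> /andP[nX /orP[/negP //|nD]] vw.
have inDB x y : x \in B -> [set x; y] \in DB.
  by move=> xB; apply/bigcupP; exists x => //; apply: imset_f.
have vB : v \notin B by apply: contra nD => /inDB.
have wB : w \notin B by apply: contra nD => /inDB; rewrite setUC.
case/negP: nX; rewrite in_set vw /=.
have -> : [set u | [set v; w] \subset nbhd G u] = nbhd G v :&: nbhd G w.
  by apply/setP => u; rewrite in_set subUset !sub1set in_setI [v \in _]nbhdC [w \in _]nbhdC.
apply: (cliques_in_common_nbhd miss dense' disj cover inner mM hm (i := i)).
  by rewrite -vi cP.
by rewrite -wi cP.
Qed.

Lemma leq_min_degree (U : finType) (G : sgraph U) u : min_degree G <= degree G u.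
Proof.
rewrite /min_degree; have := mem_index_enum u.
elim: (index_enum U) => // x s IH; rewrite inE big_cons => /orP[/eqP <-|/IH h].
  exact: geq_minl.
by apply: leq_trans (geq_minr _ _) h.
Qed.

Import Order.TTheory GRing.Theory Num.Theory.
Local Open Scope ring_scope.

Theorem theorem6 (R : realType) (r : nat) (V : finType) (H : sgraph V)
    (r_ge1 : (1 <= r)%N) (chiH : chi H = r.+1) :
  exists C : R, forall eps : R, 0 < eps ->
  exists n0 : nat, forall (n : nat) (U : finType) (G : sgraph U),
    (n0 <= n)%N -> #|U| = n ->
    (1 - 3 / (3 * r%:R - 1) + eps) * n%:R < (min_degree G)%:R :> R ->
    ~~ contains H G ->
    exists D : {set {set U}},
      [/\ D \subset edges G,
          #|D|%:R <= C * (biex n H)%:R :> R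
        & partite r (del_edges G D)].
Proof.
case: r r_ge1 chiH => // k _ chiH.
have [C CP] := partite_deletion chiH; exists C%:R => eps eps0.
pose q := Num.bound eps^-1.
have epsq : 1 <= eps * q%:R.
  have := archi_boundP (ltW (_ : 0 < eps^-1)); rewrite invr_gt0 => /(_ eps0) /ltW h.
  by rewrite -(@ler_pM2l _ eps^-1) ?invr_gt0 // mulr1 mulKf ?gt_eqF.
have q0 : (0 < q)%N.
  rewrite lt0n; apply/eqP => q0; move: epsq; rewrite q0 mulr0 ler10 //.
have [n0 nP] := CP q q0; exists n0 => n U G nn Un deg free.
rewrite -Un in nn deg *.
have [u|D [DG DC Dp]] := nP U G nn _ free; last first.
  by exists D; split=> //; rewrite -natrM ler_nat.
rewrite -(ler_nat R) natrD 2!natrM.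
have := leq_min_degree G u; rewrite -(ler_nat R) => /(lt_le_trans deg) {}deg.
have dE : (degree G u)%:R = #|U|%:R - #|~: nbhd G u|%:R :> R.
  by rewrite -(cardsC (nbhd G u)) natrD addrK.
have e0 : (#|U| %/ q)%:R <= eps * #|U|%:R.
  have : ((#|U| %/ q) * q)%:R <= #|U|%:R :> R by rewrite ler_nat leq_divM.
  rewrite natrM => h; rewrite -(@ler_pM2r _ q%:R) ?ltr0n //.
  apply: le_trans h _; rewrite mulrAC ler_peMl ?ler0n //.
have N0 : 0 < 3 * k.+1%:R - 1 :> R.
  by rewrite -[k.+1]addn1 natrD mulrDr; have : 0 <= k%:R :> R := ler0n _ _; lra.
move: deg; rewrite dE => deg.
have {}deg : (3 * k.+1%:R - 1) * #|~: nbhd G u|%:R <=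
    3 * #|U|%:R - (3 * k.+1%:R - 1) * (eps * #|U|%:R) :> R.
  have h : #|~: nbhd G u|%:R <= (3 / (3 * k.+1%:R - 1)) * #|U|%:R - eps * #|U|%:R by lra.
  apply: le_trans (ler_wpM2l (ltW N0) h) _.
  by rewrite mulrBr mulrA [_ * (3 / _)]mulrC divfK // gt_eqF.
have kE : (3 * k + 2)%:R = 3 * k.+1%:R - 1 :> R.
  by rewrite natrD natrM -[k.+1]addn1 natrD; lra.
have N1 : 1 <= 3 * k.+1%:R - 1 :> R.
  by rewrite -kE; have := ler_nat R 1 (3 * k + 2); rewrite addn2 => ->.
have : eps * #|U|%:R <= (3 * k.+1%:R - 1) * (eps * #|U|%:R).
  by rewrite ler_peMl // mulr_ge0 ?ler0n ?ltW.
by move: e0 deg; rewrite kE; lra.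
Qed.
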